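(* Let $n>1$ and let $J_1^n,\ldots,J_{p+1}^n$ be the Jordan normal forms of conjugacy classes $C_j\subset GL(n,\mathbf{C})$ (resp. $c_j\subset gl(n,\mathbf{C})$), $j=1,\ldots,p+1$. If there exists a $(p+1)$-tuple with trivial centralizer of matrices $M_j\in C_j$ satisfying $M_1\cdots M_{p+1}=I$ (resp. of matrices $A_j\in c_j$ satisfying $A_1+\cdots+A_{p+1}=0$), then the following two conditions hold: i) the $(p+1)$-tuple $(J_1^n,\ldots,J_{p+1}^n)$ satisfies the inequalities $(\alpha_n)$ and $(\beta_n)$; ii) either the $(p+1)$-tuple $(J_1^{n_s},\ldots,J_{p+1}^{n_s})$ satisfies the inequality $(\omega_{n_s})$, or $n_s=1$.
   Context: Jordan normal forms and the invariants $d(\cdot)$, $r(\cdot)$. A Jordan normal form $J$ of size $n$ is specified by a finite set of distinct eigenvalues and, for each of them, the list of sizes of its Jordan blocks (total size $n$). For a conjugacy class $C$ in $GL(n,\mathbf{C})$ or $gl(n,\mathbf{C})$ let $d(C)$ be its dimension and $r(C)=\min_{\lambda\in\mathbf{C}}\mathrm{rk}(Y-\lambda I)$ for $Y\in C$. Both depend only on the Jordan normal form, so one writes $d(J)$, $r(J)$. For a $(p+1)$-tuple $(J_1^n,\ldots,J_{p+1}^n)$ of Jordan normal forms of size $n$ put $d_j=d(J_j^n)$, $r_j=r(J_j^n)$, and consider the conditions - $(\alpha_n)$: $d_1+\cdots+d_{p+1}\ge 2n^2-2$; - $(\beta_n)$: for all $j$, $\sum_{i\ne j} r_i\ge n$;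 - $(\omega_n)$: $r_1+\cdots+r_{p+1}\ge 2n$. The sequence $n=n_0>n_1>\cdots>n_s$. Put $n_0=n$. Given the $(p+1)$-tuple $(J_j^{n_\nu})_j$ of Jordan normal forms of size $n_\nu$: if it satisfies $(\omega_{n_\nu})$, or does not satisfy $(\beta_{n_\nu})$, or if $n_\nu=1$, then stop and set $s=\nu$. Otherwise set $n_{\nu+1}=\sum_{j=1}^{p+1}r(J_j^{n_\nu})-n_\nu$ (which is $<n_\nu$), and for each $j$ obtain $J_j^{n_{\nu+1}}$ from $J_j^{n_\nu}$ by choosing (one of) the eigenvalue(s) with the greatest number of Jordan blocks and decreasing by $1$ the sizes of the $n_\nu-n_{\nu+1}$ smallest Jordan blocks with this eigenvalue (blocks of size $0$ disappear). A $(p+1)$-tuple of $n\times n$-matrices has trivial centralizer if only scalar matrices commute with all of them. *)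

(* Defs.v *)
From mathcomp Require Export all_boot all_order all_algebra.
From mathcomp Require Export boolp classical_sets reals complex mpoly.

Set Implicit Arguments.
Unset Strict Implicit.
Unset Printing Implicit Defensive.

Import GRing.Theory.

Local Open Scope ring_scope.
Local Open Scope classical_set_scope.

Section Varieties.
Context {F : fieldType}.

(* No nonzero polynomial relation between f 0, ..., f (k-1) holds identically
   on S: the f i are algebraically independent in the algebra of polynomial
   functions on S. Matrices are points of affine (n * n)-space through mxvec. *)
Definition alg_independent_on (n : nat) (S : set 'M[F]_n) (k : nat)
    (f : 'I_k -> {mpoly F[n * n]}) : Prop :=
  forall P : {mpoly F[k]},
    (forall A : 'M[F]_n, S A ->
       P.@[fun i => (f i).@[fun l => mxvec A ord0 l]] = 0) ->
    P = 0.

(* Dimension of a (locally closed) set of matrices over an algebraically closed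
   field: the transcendence degree of the algebra of polynomial functions on S,
   which is also the coordinate ring of the Zariski closure of S. Since
   S lies in affine (n * n)-space, no more than n * n functions on it can be
   algebraically independent, so bounding k by n * n loses nothing. *)
Definition dim_set (n : nat) (S : set 'M[F]_n) : nat :=
  \max_(k < (n * n).+1 |
        `[< exists f : 'I_k -> {mpoly F[n * n]}, alg_independent_on S f >]) k.

End Varieties.

Section Classes.
Context {F : fieldType}.

Definition conj_class (n : nat) (Y : 'M[F]_n) : set 'M[F]_n :=
  [set A | Y ~_{in unitmx} A].

Definition is_conj_class (n : nat) (S : set 'M[F]_n) : Prop :=
  exists Y : 'M[F]_n, S = conj_class Y.

Fact rank_shift_ex (n : nat) (Y : 'M[F]_n) :
  exists k : nat, `[< exists lam : F, \rank (Y - lam%:M) = k >].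
Proof. by exists (\rank (Y - 0%:M)); apply/asboolP; exists 0. Qed.

Definition min_rank_shift (n : nat) (Y : 'M[F]_n) : nat :=
  ex_minn (rank_shift_ex Y).

Definition trivial_centralizer (n m : nat) (M : 'I_m -> 'M[F]_n) : Prop :=
  forall B : 'M[F]_n, (forall j, B *m M j = M j *m B) -> is_scalar_mx B.

End Classes.

(* A Jordan normal form: a list of pairs (eigenvalue, sizes of its blocks). The
   order of the eigenvalues and of the sizes is immaterial; [is_jnf] requires
   the eigenvalues to be distinct, each to own at least one block, and the
   blocks to be nonempty. *)
Definition jnf (F : fieldType) : Type := seq (F * seq nat).

Section JordanNormalForms.
Context {F : fieldType}.
Implicit Types J : jnf F.

Definition jblocks J : seq (F * nat) :=
  flatten [seq [seq (x.1, b) | b <- x.2] | x <- J].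

Definition jsize J : nat := sumn [seq x.2 | x <- jblocks J].

Definition is_jnf (n : nat) J : Prop :=
  [/\ uniq [seq x.1 | x <- J],
      forall x, x \in J -> x.2 != [::] /\ all (leq 1) x.2
    & jsize J = n].

Definition jordan_block (lam : F) (k : nat) : 'M[F]_k :=
  \matrix_(i, j) (if j == i then lam else ((j : nat) == i.+1)%:R).

Fixpoint jordan_diag (s : seq (F * nat)) : 'M[F]_(sumn [seq x.2 | x <- s]) :=
  match s with
  | [::] => 0
  | x :: s' => block_mx (jordan_block x.1 x.2) 0 0 (jordan_diag s')
  end.

Definition jordan_mx J : 'M[F]_(jsize J) := jordan_diag (jblocks J).

Definition has_jnf (n : nat) (Y : 'M[F]_n) J : Prop :=
  is_jnf n J /\
  exists e : jsize J = n, Y ~_{in unitmx} (castmx (e, e) (jordan_mx J)).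

Definition jdim J : nat := dim_set (conj_class (jordan_mx J)).

Definition jrank J : nat := min_rank_shift (jordan_mx J).

Definition shrink (k : nat) (bs : seq nat) : seq nat :=
  let t := sort leq bs in
  [seq b <- [seq b.-1 | b <- take k t] ++ drop k t | 0 < b]%N.

(* An eigenvalue all of whose blocks disappear is dropped. *)
Definition jreduce (lam : F) (k : nat) J : jnf F :=
  [seq x <- [seq (if x.1 == lam then (x.1, shrink k x.2) else x) | x <- J]
  | x.2 != [::]].

(* Several eigenvalues may have the greatest number of blocks, hence a
   relation rather than a function. *)
Definition jstep (k : nat) J J' : Prop :=
  exists lam : F, exists bs : seq nat,
    [/\ (lam, bs) \in J,
        forall x, x \in J -> (size x.2 <= size bs)%N
      & J' = jreduce lam k J].

End JordanNormalForms.

Section Tuples.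
Context {F : fieldType} {p : nat}.
Implicit Types J : 'I_p.+1 -> jnf F.
Local Open Scope nat_scope.

Definition alpha (n : nat) J : Prop :=
  2 * n ^ 2 - 2 <= \sum_(j < p.+1) jdim (J j).

Definition beta (n : nat) J : Prop :=
  forall j : 'I_p.+1, n <= \sum_(i < p.+1 | i != j) jrank (J i).

Definition omega (n : nat) J : Prop :=
  2 * n <= \sum_(j < p.+1) jrank (J j).

Definition stops (n : nat) J : Prop :=
  [\/ omega n J, ~ beta n J | n = 1].

(* (ns 0, Js 0), ..., (ns s, Js s) is a sequence produced from (n, J) by the
   reduction procedure, for some choice of the eigenvalues at each step; the
   values of ns and Js beyond s are irrelevant. No subtraction is
   truncated: when the procedure continues, beta gives ns v.+1 >= 0 and the
   failure of omega gives ns v.+1 < ns v. *)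
Definition reduction_seq (n : nat) J (s : nat) (ns : nat -> nat)
    (Js : nat -> 'I_p.+1 -> jnf F) : Prop :=
  [/\ ns 0 = n /\ Js 0 = J,
      forall v : nat, v < s ->
        [/\ ~ stops (ns v) (Js v),
            ns v.+1 = \sum_(j < p.+1) jrank (Js v j) - ns v
          & forall j : 'I_p.+1,
              jstep (ns v - ns v.+1) (Js v j) (Js v.+1 j)]
    & stops (ns s) (Js s)].

End Tuples.

(* Main.v *)
(* A tuple with trivial centralizer is a brick (all endomorphisms are scalar) of
   a star-shaped quiver subject to (multiplicative) preprojective relations: the
   center is C^n, and the i-th vertex of the j-th arm is the image of
   (M_j - e_0) ... (M_j - e_(i-1)), so that n minus its dimension is a partial
   sum of the columns of the partitions conjugate to the block sizes of J_j.
   At a vertex of a brick the incoming maps are jointly surjective or the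
   outgoing ones jointly injective, for otherwise a map through the cokernel
   and the kernel would be a nonscalar endomorphism. In the first case
   replacing the vertex by the kernel of the incoming maps gives a brick again,
   and the second case is its transpose; hence simple reflections turn
   dimension vectors of bricks into dimension vectors of bricks, whatever the
   eigenvalues are. One step of the procedure is the reflection at the center,
   which lowers the largest column of each J_j by n - n_1, followed by
   reflections along the arms that sort the columns again. If (beta_n) failed
   for n > 1, the reflection at the center would produce a negative column, and
   pushing it to the end of its arm a negative dimension.
   Inequality (alpha_n) is Scott's lemma for the adjoint action, the dimension
   of a conjugacy class being at least the rank of X |-> [X, A]. *)
Require Import Defs.
From mathcomp Require Import ring zify.

Set Implicit Arguments.
Unset Strict Implicit.
Unset Printing Implicit Defensive.

Import GRing.Theory.
Local Open Scope ring_scope.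

(** * Kernels and additive reflections *)

Section Corners.
Context {F : fieldType} {N : nat}.
Implicit Types (E f : 'M[F]_N.+1).

(* Idempotents of a fixed size stand for vector spaces, and maps act on row
   vectors, so that products of maps are read from left to right. *)
Definition hom (E E' f : 'M[F]_N.+1) : Prop := E * f = f /\ f * E' = f.

Let mulE (A B : 'M[F]_N.+1) : A * B = A *m B. Proof. by []. Qed.

Lemma idem_base_mulmx E : E * E = E -> row_base E *m col_base E = 1%:M.
Proof.
move=> EE; apply: (row_full_inj (col_base_full E)).
apply: (row_free_inj (row_base_free E)).
by rewrite /mulmxr mulmx1 mulmxA mulmx_base -mulmxA mulmx_base; exact: EE.
Qed.

Section Kernel.
Variables (m : nat) (E0 : 'M[F]_N.+1) (E al : 'I_m -> 'M[F]_N.+1).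
Hypotheses (E0E0 : E0 * E0 = E0)
  (hal : forall k, hom (E k) E0 (al k))
  (epi : forall f, E0 * f = f -> (forall k, al k * f = 0) -> f = 0)
  (r : 'I_m -> nat)
  (p : forall k, 'M[F]_(N.+1, r k)) (q : forall k, 'M[F]_(r k, N.+1))
  (pq : forall k, p k *m q k = E k) (qp : forall k, q k *m p k = 1%:M)
  (bound : (\sum_k r k <= N.+1 + \rank E0)%N).

Let qE k : q k *m E k = q k. Proof. by rewrite -pq mulmxA qp mul1mx. Qed.
Let C := \mxcol_k (q k *m al k).
Let K := kermx C.
Let G := row_base K.

Let CE0 : C *m E0 = C.
Proof.
rewrite mxcol_mul; apply/mxcolP => k; rewrite !mxcolK -mulmxA.
by rewrite -[al k *m E0]/(al k * E0) (hal k).2.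
Qed.

Let rankC : \rank C = \rank E0.
Proof.
apply/eqP; rewrite eqn_leq; apply/andP; split; apply: mxrankS.
  by rewrite -CE0 submxMl.
(* Joint surjectivity is tested on the cokernel of [C]: [E0] must vanish there, so its row space
   lies in that of [C]. *)
rewrite submxE; apply/eqP/epi.
  by rewrite mulE mulmxA; congr (_ *m _); exact: E0E0.
move=> k; rewrite -(hal k).1 -mulrA -!mulmxE -pq -!mulmxA.
have := mulmx_coker C; rewrite -{1}CE0 mxcol_mul mxcol_mul.
move=> /(congr1 (fun X => submxcol X k)); rewrite mxcolK submxcol0 -!mulmxA => ->.
by rewrite mulmx0.
Qed.

Let rankK : (\rank K + \rank E0 = \sum_k r k)%N.
Proof. by rewrite mxrank_ker rankC subnK // -rankC rank_leq_row. Qed.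

(** [C] is the total map from the direct sum of the spaces [E k] to [E0], in coordinates; [E']
    stands for its kernel and [ga] for the components of the inclusion. The hypothesis [bound] makes
    the kernel fit into size [N.+1]. The last three clauses are the universal property of the
    kernel, the joint injectivity of the inclusion, and the fact that [E0] is its cokernel, because
    [C] is onto. *)
Lemma kernel_object_split : exists E' (ga : 'I_m -> 'M[F]_N.+1),
  [/\ E' * E' = E', (\rank E' + \rank E0 = \sum_k r k)%N,
      forall k, hom E' (E k) (ga k) & \sum_k ga k * al k = 0] /\
  [/\ forall H, (forall k, H k * E k = H k) -> \sum_k H k * al k = 0 ->
        exists f, f * E' = f /\ forall k, f * ga k = H k,
      forall f, f * E' = f -> (forall k, f * ga k = 0) -> f = 0
    & forall H, (forall k, E k * H k = H k) -> \sum_k ga k * H k = 0 ->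
        exists f, E0 * f = f /\ forall k, al k * f = H k].
Proof.
have kn : (\rank K <= N.+1)%N by rewrite -(leq_add2r (\rank E0)) rankK.
pose P : 'M[F]_(N.+1, \rank K) := pid_mx (\rank K).
pose Q : 'M[F]_(\rank K, N.+1) := pid_mx (\rank K).
have QP : Q *m P = 1%:M by rewrite mul_pid_mx minnn (minn_idPr kn) pid_mx_1.
have GC : G *m C = 0.
  by apply/sub_kermxP; rewrite eq_row_base.
pose ga k := P *m submxrow G k *m q k.
have gaM k x (X : 'M_(N.+1, x)) : ga k *m X = P *m (submxrow G k *m (q k *m X)).
  by rewrite !mulmxA.
have sumga x (H : 'I_m -> 'M_(N.+1, x)) :
    \sum_k ga k *m H k = P *m (G *m \mxcol_k (q k *m H k)).
  rewrite -[G]submxrowK mul_mxrow_mxcol mulmx_sumr; apply: eq_bigr => k _.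
  by rewrite gaM.
exists (P *m Q), ga; split; split.
- by rewrite mulE mulmxA -[P *m Q *m P]mulmxA QP mulmx1.
- apply: etrans rankK; congr addn.
  by rewrite mul_pid_mx minnn (minn_idPr (leqnn _)) rank_pid_mx.
- move=> k; split; rewrite mulE /ga.
    by rewrite !mulmxA -[P *m Q *m P]mulmxA QP mulmx1.
  by rewrite -!mulmxA qE.
- by apply: etrans (sumga _ al) _; rewrite GC mulmx0.
- move=> H HE; move=> H0.
  pose D := \mxrow_k (H k *m p k).
  have /submxP [X DX] : (D <= G)%MS.
    rewrite eq_row_base; apply/sub_kermxP; rewrite mul_mxrow_mxcol -[RHS]H0.
    apply: eq_bigr => k _.
    by rewrite mulmxA -(mulmxA (H k)) pq; congr (_ *m _); exact: HE.
  exists (X *m Q); split=> [|k]; rewrite ?mulE.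
    by rewrite mulmxA -(mulmxA _ Q P) QP mulmx1.
  rewrite /ga !mulmxA -(mulmxA _ Q P) QP mulmx1 mul_submxrow -DX.
  by rewrite mxrowK -mulmxA pq; exact: HE.
- move=> f fE' f0; rewrite -fE' mulE mulmxA.
  suff -> : f *m P = 0 by rewrite mul0mx.
  apply: (row_free_inj (row_base_free K)); rewrite /mulmxr mul0mx -/G.
  rewrite -[G]submxrowK mul_mxrow; apply/mxrowP => k; rewrite mxrowK submxrow0.
  rewrite -[LHS]mulmx1 -qp mulmxA [_ *m q k](_ : _ = 0) ?mul0mx //.
  by rewrite -[RHS](f0 k) mulE /ga !mulmxA.
- move=> H HE H1; have {}H1 := etrans (esym (sumga _ H)) H1.
  pose HH := \mxcol_k (q k *m H k).
  have KH : K *m HH = 0.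
    have: G *m HH = 0.
      by rewrite -[LHS]mul1mx -QP -mulmxA H1 mulmx0.
    by move=> GH; rewrite -(mulmx_base K) -mulmxA GH mulmx0.
  (* [HH] vanishes on the kernel of [C], which contains the rows of [1 - C *m pinvmx C]; hence it
     factors through [C]. *)
  have CH : C *m (pinvmx C *m HH) = HH.
    apply/eqP; rewrite eq_sym -subr_eq0 -{1}[HH]mul1mx mulmxA -mulmxBl.
    have /submxP [X ->] : (1%:M - C *m pinvmx C <= K)%MS.
      by apply/sub_kermxP; rewrite mulmxBl mul1mx mulmxKpV // subrr.
    by rewrite -mulmxA KH mulmx0.
  set X := pinvmx C *m HH in CH.
  exists (E0 *m X); split; first by rewrite -[E0 *m X]/(E0 * X) mulrA E0E0.
  move=> k; rewrite -(hal k).1 -(HE k) !mulE -pq -!mulmxA; congr (_ *m _).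
  have /(congr1 (fun X => submxcol X k)) := CH.
  by rewrite -{1}CE0 mxcol_mul mxcol_mul !mxcolK -!mulmxA.
Qed.

End Kernel.

Lemma kernel_object m (E0 : 'M[F]_N.+1) (E al : 'I_m -> 'M[F]_N.+1) :
  E0 * E0 = E0 -> (forall k, E k * E k = E k) ->
  (forall k, hom (E k) E0 (al k)) ->
  (forall f, E0 * f = f -> (forall k, al k * f = 0) -> f = 0) ->
  (\sum_k \rank (E k) <= N.+1 + \rank E0)%N ->
  exists E' (ga : 'I_m -> 'M[F]_N.+1),
  [/\ E' * E' = E', (\rank E' + \rank E0 = \sum_k \rank (E k))%N,
      forall k, hom E' (E k) (ga k) & \sum_k ga k * al k = 0] /\
  [/\ forall H, (forall k, H k * E k = H k) -> \sum_k H k * al k = 0 ->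
        exists f, f * E' = f /\ forall k, f * ga k = H k,
      forall f, f * E' = f -> (forall k, f * ga k = 0) -> f = 0
    & forall H, (forall k, E k * H k = H k) -> \sum_k ga k * H k = 0 ->
        exists f, E0 * f = f /\ forall k, al k * f = H k].
Proof.
move=> E0E0 EE hal epi bound.
apply: (kernel_object_split E0E0 hal epi
  (p := fun k => col_base (E k)) (q := fun k => row_base (E k))) bound => k.
  exact: mulmx_base.
exact: idem_base_mulmx.
Qed.
Lemma homZ E1 E2 c f : hom E1 E2 f -> hom E1 E2 (c *: f).
Proof.
by move=> [f1 f2]; split; rewrite (=^~ scalerAl, =^~ scalerAr) ?f1 ?f2.
Qed.

Lemma homN E1 E2 f : hom E1 E2 f -> hom E1 E2 (- f).
Proof. by move=> [f1 f2]; split; rewrite (mulNr, mulrN) ?f1 ?f2. Qed.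

Lemma hom0 E1 E2 : hom E1 E2 0.
Proof. by split; rewrite (mulr0, mul0r). Qed.

Section VertexEndo.
Variable (m : nat).
Local Notation M := 'M[F]_N.+1.

Definition vertex_endo (E0 : M) (E a b : 'I_m -> M) (th0 : M)
    (th : 'I_m -> M) : Prop :=
  [/\ hom E0 E0 th0, forall k, hom (E k) (E k) (th k),
      forall k, th0 * a k = a k * th k & forall k, b k * th0 = th k * b k].

Definition vertex_epi (E0 : M) (b : 'I_m -> M) : Prop :=
  forall f, E0 * f = f -> (forall k, b k * f = 0) -> f = 0.

(* The new vertex space is the kernel of the incoming maps; every endomorphism
   of the new representation induces one of the old representation. *)
Definition reflects_to (E0 : M) (E a b : 'I_m -> M) (E0' : M)
    (a' b' : 'I_m -> M) : Prop :=
  [/\ E0' * E0' = E0', (\rank E0' + \rank E0 = \sum_k \rank (E k))%N,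
      forall k, hom E0' (E k) (a' k) & forall k, hom (E k) E0' (b' k)] /\
  (forall th0' th, vertex_endo E0' E a' b' th0' th ->
     (exists th0, vertex_endo E0 E a b th0 th) /\
     (forall c, (forall k, th k = c *: E k) -> th0' = c *: E0')).

(** The new outgoing maps are the components of the inclusion of the kernel. The family [b k * a l],
    composed with the [b l] and summed over [l], gives [t *: b k]; subtracting [t] on the diagonal
    moves it into the kernel, so that it lifts to a new incoming map. The parameter of the relation
    changes sign, as for deformed preprojective relations. *)
Lemma add_reflect (E0 : M) (E a b : 'I_m -> M) t :
  E0 * E0 = E0 -> (forall k, E k * E k = E k) ->
  (forall k, hom E0 (E k) (a k)) -> (forall k, hom (E k) E0 (b k)) ->
  \sum_k a k * b k = t *: E0 -> vertex_epi E0 b ->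
  (\sum_k \rank (E k) <= N.+1 + \rank E0)%N ->
  exists E0' a' b', [/\ reflects_to E0 E a b E0' a' b',
    forall k l, b' k * a' l = b k * a l - (if l == k then t *: E k else 0)
    & \sum_k a' k * b' k = (- t) *: E0'].
Proof.
move=> E00 EE ha hb ab epi bound.
have [E0' [ga [[E00' rk hga ga0] [lift mono desc]]]] :=
  kernel_object E00 EE hb epi bound.
pose G k l := b k * a l - (if l == k then t *: E k else 0).
have GE k l : G k l * E l = G k l.
  rewrite /G mulrBl -mulrA (ha l).2; case: eqP => [->|_]; last by rewrite mul0r.
  by rewrite -scalerAl EE.
have EG k l : E k * G k l = G k l.
  rewrite /G mulrBr mulrA (hb k).1; case: eqP => [->|_]; last by rewrite mulr0.
  by rewrite -scalerAr EE.
have Gb k : \sum_l G k l * b l = 0.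
  transitivity (\sum_l (b k * (a l * b l) -
                        if l == k then t *: E k * b l else 0)).
    apply: eq_bigr => l _; rewrite mulrBl mulrA; congr (_ - _).
    by case: (l == k); rewrite ?mul0r.
  rewrite sumrB -mulr_sumr ab -big_mkcond big_pred1_eq -scalerAr -scalerAl.
  by rewrite (hb k).1 (hb k).2 subrr.
have [de de_spec] := choice (fun k => lift (G k) (GE k) (Gb k)).
have deE k : de k * E0' = de k := (de_spec k).1.
have dega k l : de k * ga l = G k l := (de_spec k).2 l.
have hde k : hom (E k) E0' (de k).
  split=> //; apply/eqP; rewrite -subr_eq0; apply/eqP/mono => [|l].
    by rewrite mulrBl -mulrA deE.
  by rewrite mulrBl -mulrA dega EG subrr.
exists E0', ga, de; split=> //; last first.
  apply/eqP; rewrite -subr_eq0; apply/eqP/mono => [|l].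
    rewrite mulrBl -scalerAl E00' mulr_suml; congr (_ - _).
    by apply: eq_bigr => k _; rewrite -mulrA deE.
  rewrite mulrBl -scalerAl (hga l).1 mulr_suml.
  under eq_bigr do rewrite -mulrA dega mulrBr mulrA.
  rewrite sumrB -mulr_suml ga0 mul0r sub0r.
  rewrite (eq_bigr (fun i => if i == l then t *: ga l else 0)) => [|k _].
    by rewrite -big_mkcond big_pred1_eq scaleNr subrr.
  by rewrite eq_sym; case: eqP => [->|_]; rewrite ?mulr0 // -scalerAr (hga l).2.
split=> // th0' th [hth0' hth eqa eqb].
split=> [|c thc]; last first.
  apply/eqP; rewrite -subr_eq0; apply/eqP/mono => [|l].
    by rewrite mulrBl hth0'.2 -scalerAl E00'.
  by rewrite mulrBl eqa thc -scalerAl -scalerAr (hga l).1 (hga l).2 subrr.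
(* [E0] is the cokernel of the inclusion [ga]; the maps [th k * b k] vanish on the kernel, hence
   descend to an endomorphism of [E0]. *)
have [||th0 [E0th0 bth0]] := desc (fun k => th k * b k).
- by move=> k; rewrite mulrA (hth k).1.
- under eq_bigr do rewrite mulrA -eqa -mulrA.
  by rewrite -mulr_sumr ga0 mulr0.
exists th0; split=> //.
- split=> //; apply/eqP; rewrite -subr_eq0; apply/eqP/epi => [|k].
    by rewrite mulrBr mulrA E0th0.
  by rewrite mulrBr mulrA bth0 -mulrA (hb k).2 subrr.
- move=> l; apply/eqP; rewrite -subr_eq0; apply/eqP/epi => [|k].
    by rewrite mulrBr !mulrA E0th0 (ha l).1.
  rewrite mulrBr !mulrA bth0 -(mulrA (th k)).
  have ba : b k * a l = G k l + (if l == k then t *: E k else 0) by rewrite subrK.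
  rewrite ba mulrDr mulrDl -dega mulrA -eqb -!mulrA eqa opprD addrACA subrr.
  rewrite add0r; case: eqP => [->|_]; last by rewrite mul0r mulr0 subrr.
  by rewrite -scalerAl -scalerAr (hth k).1 (hth k).2 subrr.
Qed.

End VertexEndo.
End Corners.

(** * Multiplicative reflections *)

Section MultiplicativeReflection.
Context {F : fieldType} {N : nat}.
Local Notation M := 'M[F]_N.+1.

Section Telescopes.
Variables (m : nat) (q : F) (E a b ga de : nat -> M).
Hypothesis gaE : forall k, ga k * E k = ga k.

Definition tail_prod k := \prod_(k <= l < m) (1 + a l * b l).
Let Q := tail_prod.

Lemma tail_prod_rec k : (k < m)%N -> Q k = (1 + a k * b k) * Q k.+1.
Proof. by move=> km; rewrite /Q /tail_prod big_ltn. Qed.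

Lemma sum_tail_prod k n : (k <= n <= m)%N ->
  \sum_(k <= l < n) a l * (b l * Q l.+1) = Q k - Q n.
Proof.
move=> /andP [kn nm]; rewrite (telescope_sumr_eq (fun l => - Q l) _ kn).
  by rewrite opprK addrC.
move=> l /andP [_ ln]; rewrite opprK addrC [Q l]tail_prod_rec; last first.
  exact: leq_trans ln nm.
by rewrite mulrDl mul1r addrAC subrr add0r mulrA.
Qed.

Hypotheses (ga0 : \sum_(0 <= k < m) ga k * (b k * Q k.+1) = 0)
  (dega : forall k l, (k < m)%N -> (l < m)%N -> de k * ga l =
     if (k < l)%N then b k * a l else
     if (l < k)%N then q^-1 *: (b k * a l) else
     q^-1 *: (E k + b k * a k) - E k).

Let R k := \prod_(0 <= l < k) (1 + ga l * de l).
Let w k := R k * ga k.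
Let Y k := \sum_(0 <= l < k) w l * b l.

Lemma head_prodE k : R k = 1 + \sum_(0 <= l < k) w l * de l.
Proof.
elim: k => [|k IH]; first by rewrite /R !big_nil addr0.
rewrite big_nat_recr //= addrA -IH /R big_nat_recr //= -/(R k).
by rewrite mulrDr mulr1 mulrA.
Qed.

Let wE k : (k < m)%N -> w k = ga k + Y k * a k.
Proof.
move=> km; rewrite /w head_prodE mulrDl mul1r /Y !mulr_suml; congr (_ + _).
apply: eq_big_nat => l /andP [_ lk].
by rewrite -!mulrA dega ?lk // (ltn_trans lk).
Qed.

Let Yrec k : Y k.+1 = Y k + w k * b k.
Proof. by rewrite /Y big_nat_recr. Qed.

(** The kernel relation [ga0] involves incoming maps twisted by tail products, while [Y] sums the
    untwisted ones with weights [w]. This identity compares the two; at [k = m], where the tail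
    product is 1, it yields [Y m = 0]. *)
Let YQ k : (k <= m)%N -> Y k * Q k = \sum_(0 <= l < k) ga l * (b l * Q l.+1).
Proof.
elim: k => [|k IH] km; first by rewrite /Y !big_nil mul0r.
rewrite big_nat_recr //= -IH ?(ltnW km) // Yrec wE // (tail_prod_rec km).
rewrite !mulrDl mul1r !mulrDr -!mulrA -!addrA; congr (_ + _).
by rewrite addrC.
Qed.

Let Ym : Y m = 0.
Proof. by rewrite -[Y m]mulr1 -[1](_ : Q m = 1) ?YQ // /Q /tail_prod big_geq. Qed.

(** Expand the product and split the sum at [i]. The lower terms give [Y i * a i]; the upper ones
    carry [q^-1] and, since [Y m = 0], add up to [- q^-1 *: (Y i.+1 * a i)]. Together with the
    diagonal term all but [q^-1 *: ga i] cancels. *)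
Lemma head_prod_mulr i : (i < m)%N -> R m * ga i = q^-1 *: ga i.
Proof.
move=> im; rewrite head_prodE mulrDl mul1r mulr_suml.
have wE_i : w i * E i = w i by rewrite /w -mulrA gaE.
have lo : \sum_(0 <= l < i) w l * de l * ga i = Y i * a i.
  rewrite /Y mulr_suml; apply: eq_big_nat => l /andP [_ li].
  by rewrite -(mulrA (w l)) dega ?li ?mulrA // (ltn_trans li).
have hi : \sum_(i.+1 <= l < m) w l * de l * ga i = - (q^-1 *: (Y i.+1 * a i)).
  transitivity (q^-1 *: ((\sum_(i.+1 <= l < m) w l * b l) * a i)).
    rewrite mulr_suml scaler_sumr; apply: eq_big_nat => l /andP [il lm].
    by rewrite -!(mulrA (w l)) dega // ltnNge (ltnW il) /= il -scalerAr mulrA.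
  rewrite -scalerN -mulNr; congr (_ *: (_ * _)).
  apply/eqP; rewrite -subr_eq0 opprK addrC -big_cat_nat //= -/(Y m).
  by rewrite Ym.
rewrite (big_cat_nat (n := i)) ?(ltnW im) //= [\sum_(i <= _ < m) _]big_ltn // lo hi.
rewrite -(mulrA (w i)) dega // ltnn mulrBr -scalerAr mulrDr wE_i Yrec mulrA mulrDl.
rewrite [in RHS](_ : ga i = w i - Y i * a i); last by rewrite wE // addrK.
rewrite addrA -wE // addrA [w i + (_ - _)]addrCA subrr addr0 -scalerBr.
by rewrite opprD addrACA subrr addr0.
Qed.

End Telescopes.
End MultiplicativeReflection.

Section MulReflect.
Context {F : fieldType} {N m : nat}.
Local Notation M := 'M[F]_N.+1.

Definition extend_fun (f : 'I_m -> M) (i : nat) : M :=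
  if insub i is Some k then f k else 0.

Lemma extend_funE f (k : 'I_m) : extend_fun f k = f k.
Proof. by rewrite /extend_fun valK. Qed.

Lemma extend_funP (P : M -> Prop) (f : 'I_m -> M) :
  P 0 -> (forall k, P (f k)) -> forall i, P (extend_fun f i).
Proof. by rewrite /extend_fun => P0 Pf i; case: insub. Qed.

Lemma corner_scaleM (E0 : M) (c d : F) : E0 * E0 = E0 ->
  (1 + (c - 1) *: E0) * (1 + (d - 1) *: E0) = 1 + (c * d - 1) *: E0.
Proof.
move=> E00; rewrite mulrDl mul1r mulrDr mulr1 -scalerAl -scalerAr E00 scalerA.
by rewrite -!addrA -!scalerDl; congr (_ + _ *: _); ring.
Qed.

Variables (E0 : M) (E a b : 'I_m -> M) (q : F).
Hypotheses (E00 : E0 * E0 = E0) (EE : forall k, E k * E k = E k)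
  (ha : forall k, hom E0 (E k) (a k)) (hb : forall k, hom (E k) E0 (b k))
  (q0 : q != 0) (prodq : \prod_k (1 + a k * b k) = 1 + (q - 1) *: E0)
  (epi : vertex_epi E0 b) (bound : (\sum_k \rank (E k) <= N.+1 + \rank E0)%N).

Let A := extend_fun a.
Let B := extend_fun b.
Let EX := extend_fun E.
Let Q := tail_prod m A B.
(** Twisting by tail products makes the relation additive: the sum of the [a k * al k] telescopes to
    [Q 0 - 1 = (q - 1) *: E0]. The new vertex will be the kernel of these twisted maps. *)
Let al (k : 'I_m) := b k * Q k.+1.

Let Q_comm k : Q k * E0 = E0 * Q k.
Proof.
rewrite /Q /tail_prod; elim/big_rec: _ => [|i x _ IH]; first by rewrite mul1r mulr1.
rewrite -mulrA IH !mulrA; congr (_ * _); rewrite mulrDl mulrDr mul1r mulr1.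
congr (_ + _); rewrite mulrA /A /B /extend_fun; case: insub => [j|].
  by rewrite (ha j).1 -mulrA (hb j).2.
by rewrite !(mulr0, mul0r).
Qed.

Let hal k : hom (E k) E0 (al k).
Proof.
by rewrite /al; split; rewrite ?mulrA ?(hb k).1 // -mulrA Q_comm mulrA (hb k).2.
Qed.

Let Q_rec (k : 'I_m) : Q k = (1 + a k * b k) * Q k.+1.
Proof. by rewrite /Q tail_prod_rec // /A /B !extend_funE. Qed.

Let Q0 : Q 0 = 1 + (q - 1) *: E0.
Proof.
rewrite -prodq /Q /tail_prod big_mkord.
by apply: eq_bigr => k _; rewrite /A /B !extend_funE.
Qed.

Let Qm : Q m = 1.
Proof. by rewrite /Q /tail_prod big_geq. Qed.

Let descend (P : nat -> Prop) :
  P m -> (forall k : 'I_m, P k.+1 -> P k) -> forall k, (k <= m)%N -> P k.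
Proof.
move=> Pm Pk i im; rewrite -(subKn im); elim: (m - i)%N (leq_subr i m) => [|d IH] dm.
  by rewrite subn0.
have lt : (m - d.+1 < m)%N by rewrite ltn_subrL (leq_ltn_trans _ dm).
apply: (Pk (Ordinal lt)); rewrite /= subnSK //; exact/IH/ltnW.
Qed.

(** If every [al k] kills [f], downward induction gives [Q k * f = f], since the factor
    [1 + a k * b k] adds only [a k * (al k * f)]. Then [b k * f = al k * f = 0]. *)
Let epi_al : vertex_epi E0 al.
Proof.
move=> f E0f alf.
have Qf : forall k, (k <= m)%N -> Q k * f = f.
  apply: descend => [|k Qf]; first by rewrite Qm mul1r.
  rewrite Q_rec -mulrA Qf mulrDl mul1r -mulrA -{2}Qf [b k * _]mulrA.
  by rewrite [b k * Q _ * f]alf mulr0 addr0.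
by apply: epi => // k; rewrite -[RHS](alf k) /al -mulrA Qf.
Qed.

Let G (k l : 'I_m) := if (k < l)%N then b k * a l else
  if (l < k)%N then q^-1 *: (b k * a l) else q^-1 *: (E k + b k * a k) - E k.

Let GE (k l : 'I_m) : G k l * E l = G k l.
Proof.
rewrite /G; case: (ltngtP k l) => [_|_|/val_inj <-].
- by rewrite -mulrA (ha l).2.
- by rewrite -scalerAl -mulrA (ha l).2.
- by rewrite mulrBl -scalerAl mulrDl EE -mulrA (ha k).2.
Qed.

Let EG (k l : 'I_m) : E k * G k l = G k l.
Proof.
rewrite /G; case: (ltngtP k l) => _.
- by rewrite mulrA (hb k).1.
- by rewrite -scalerAr mulrA (hb k).1.
- by rewrite mulrBr -scalerAr mulrDr EE mulrA (hb k).1.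
Qed.

(** By telescoping, the terms below [k] sum to [q^-1 *: (b k * (Q 0 - Q k))] and those above to
    [b k * (Q k.+1 - 1)]; with [Q 0 = 1 + (q - 1) *: E0] they cancel the diagonal term. So each row
    of [G] lifts to the kernel. *)
Let Gal (k : 'I_m) : \sum_l G k l * al l = 0.
Proof.
pose g l := if (k < l)%N then b k * (A l * (B l * Q l.+1)) else
  if (l < k)%N then q^-1 *: (b k * (A l * (B l * Q l.+1))) else
  (q^-1 *: (E k + b k * a k) - E k) * (b k * Q k.+1).
rewrite (eq_bigr (fun l : 'I_m => g l)) => [|l _]; last first.
  rewrite /G /g /al /A /B !extend_funE.
  case: (ltngtP k l) => [_|_|/val_inj -> //]; first by rewrite !mulrA.
  by rewrite -scalerAl !mulrA.
rewrite -(big_mkord xpredT g) (big_cat_nat (n := k)) ?(ltnW (ltn_ord k)) //=.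
rewrite [\sum_(k <= _ < m) _]big_ltn //.
have -> : \sum_(0 <= l < k) g l = q^-1 *: (b k * (Q 0 - Q k)).
  rewrite -(@sum_tail_prod _ _ m A B) ?(ltnW (ltn_ord k)) // mulr_sumr scaler_sumr.
  by apply: eq_big_nat => l /andP [_ lk]; rewrite /g ltnNge (ltnW lk) /= lk.
have -> : \sum_(k.+1 <= l < m) g l = b k * (Q k.+1 - Q m).
  rewrite -(@sum_tail_prod _ _ m A B) ?ltn_ord ?leqnn // mulr_sumr.
  by apply: eq_big_nat => l /andP [kl _]; rewrite /g kl.
rewrite /g ltnn Q0 Qm !mulrBr Q_rec mulrDl mul1r !mulrDr mulr1 -scalerAr (hb k).2.
rewrite scalerBl scale1r [b k + (_ - _)]addrCA subrr addr0 mulrBl -scalerAl mulrDl.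
rewrite [E k * _]mulrA (hb k).1 !mulrA; set z := b k * Q k.+1 + _.
rewrite [X in _ + X]addrA subrK scalerBr scalerA mulVf // scale1r.
by rewrite addrA subrK subrr.
Qed.

Lemma mul_reflect : exists E0' a' b',
  [/\ reflects_to E0 E a b E0' a' b',
      forall k, b' k * a' k = q^-1 *: (E k + b k * a k) - E k
    & \prod_k (1 + a' k * b' k) = 1 + (q^-1 - 1) *: E0'].
Proof.
have [E0' [ga [[E00' rk hga ga0] [lift mono desc]]]] :=
  kernel_object E00 EE hal epi_al bound.
have [de de_spec] := choice (fun k => lift (G k) (GE k) (Gal k)).
have deE k : de k * E0' = de k := (de_spec k).1.
have dega k l : de k * ga l = G k l := (de_spec k).2 l.
have hde k : hom (E k) E0' (de k).
  split=> //; apply/eqP; rewrite -subr_eq0; apply/eqP/mono => [|l].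
    by rewrite mulrBl -mulrA deE.
  by rewrite mulrBl -mulrA dega EG subrr.
have deX : forall k, extend_fun de k * E0' = extend_fun de k.
  by apply: (extend_funP (P := fun x => x * E0' = x)) => //; rewrite mul0r.
exists E0', ga, de; split; last first.
- have prodE : \prod_k (1 + ga k * de k) =
      \prod_(0 <= k < m) (1 + extend_fun ga k * extend_fun de k).
    by rewrite big_mkord; apply: eq_bigr => k _; rewrite !extend_funE.
  rewrite prodE; apply/eqP; rewrite -subr_eq0 opprD addrA; apply/eqP/mono => [|l].
    rewrite mulrBl -scalerAl E00' head_prodE addrC addKr; congr (_ - _).
    rewrite mulr_suml; apply: eq_bigr => k _.
    by rewrite -(mulrA _ (extend_fun de k)) deX.
  rewrite !mulrBl mul1r -scalerAl (hga l).1 -{1}(extend_funE ga l).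
  rewrite (@head_prod_mulr _ _ m q EX A B) //.
  + by rewrite extend_funE scalerBl scale1r subrr.
  + move=> k; rewrite /EX /extend_fun; case: insub => [j|]; last by rewrite mul0r.
    exact: (hga j).2.
  + rewrite big_mkord -[RHS]ga0; apply: eq_bigr => k _.
    by rewrite /al /B !extend_funE.
  + move=> i j im jm; rewrite (extend_funE de (Ordinal im)).
    rewrite (extend_funE ga (Ordinal jm)) dega /A /B /EX.
    rewrite (extend_funE b (Ordinal im)) (extend_funE a (Ordinal jm)).
    rewrite (extend_funE E (Ordinal im)) (extend_funE a (Ordinal im)).
    by rewrite /G /=.
- by move=> k; rewrite dega /G ltnn.
split=> // th0' th [hth0' hth eqa eqb].
split=> [|c thc]; last first.
  apply/eqP; rewrite -subr_eq0; apply/eqP/mono => [|l].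
    by rewrite mulrBl hth0'.2 -scalerAl E00'.
  by rewrite mulrBl eqa thc -scalerAl -scalerAr (hga l).1 (hga l).2 subrr.
have [||th0 [E0th0 alth0]] := desc (fun k => th k * al k).
- by move=> k; rewrite mulrA (hth k).1.
- under eq_bigr do rewrite mulrA -eqa -mulrA.
  by rewrite -mulr_sumr ga0 mulr0.
(* The new maps compose to the entries of [G], so [th] commutes with these; cancelling the nonzero
   factor [q^-1] and the identity terms leaves [b k * a i]. *)
have baC k i : th k * (b k * a i) = b k * a i * th i.
  have : th k * G k i = G k i * th i.
    by rewrite -!dega mulrA -eqb -!mulrA eqa.
  rewrite /G; case: (ltngtP k i) => [_ //|_|/val_inj <-].
    by rewrite -scalerAl -scalerAr => /scalerI; apply; rewrite invr_eq0.
  rewrite mulrBl mulrBr (hth k).1 (hth k).2 => /addIr.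
  rewrite -scalerAl -scalerAr => /scalerI; rewrite mulrDl mulrDr.
  by rewrite (hth k).1 (hth k).2 => H; apply/addrI/H; rewrite invr_eq0.
have QC n : (n <= m)%N -> forall k i,
    th k * (b k * (Q n * a i)) = b k * (Q n * a i) * th i.
  move: n; apply: descend => [k i|n IH k i]; first by rewrite Qm mul1r baC.
  rewrite Q_rec !mulrDl mul1r mulrDr mulrDl mulrDr IH; congr (_ + _).
  transitivity (b k * a n * (th n * (b n * (Q n.+1 * a i)))).
    by rewrite [RHS]mulrA -baC -!mulrA.
  by rewrite IH -!mulrA.
have th0E : th0 * E0 = th0.
  apply/eqP; rewrite -subr_eq0; apply/eqP/epi_al => [|k].
    by rewrite mulrBr mulrA E0th0.
  by rewrite mulrBr mulrA alth0 -mulrA (hal k).2 subrr.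
have th0a l : th0 * a l = a l * th l.
  apply/eqP; rewrite -subr_eq0; apply/eqP/epi_al => [|k].
    by rewrite mulrBr !mulrA E0th0 (ha l).1.
  rewrite mulrBr mulrA alth0 /al -!mulrA QC ?ltn_ord //.
  by rewrite -!mulrA subrr.
(* [Q 0] is invertible because [q] is nonzero, and a left inverse of [Q k] gives one of its right
   factor [Q k.+1]; for square matrices it is two-sided. *)
have invQ k : (k <= m)%N -> exists X : M, Q k * X = 1.
  suff: (k <= m)%N -> exists X : M, X * Q k = 1.
    by move=> H km; have [X XQ] := H km; exists X; exact: mulmx1C.
  elim: k => [|k IH] km.
    exists (1 + (q^-1 - 1) *: E0).
    by rewrite Q0 corner_scaleM // mulVf // subrr scale0r addr0.
  have [X XQ] := IH (ltnW km); exists (X * (1 + A k * B k)).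
  by rewrite -mulrA -tail_prod_rec.
(* So far [th0] is compatible with the twisted maps only. Going down from the last arm,
   compatibility with the later arms makes [th0] commute with [Q n.+1], which can then be
   cancelled. *)
have bth0 n : (n <= m)%N -> forall k : 'I_m, (n <= k)%N -> b k * th0 = th k * b k.
  move: n; apply: descend => [k|n IH k]; first by rewrite leqNgt ltn_ord.
  rewrite leq_eqVlt => /orP [/eqP/val_inj <-|]; last exact: IH.
  have QCt : Q n.+1 * th0 = th0 * Q n.+1.
    rewrite /Q /tail_prod !big_nat; elim/big_rec: _ => [|i x /andP [ni im] xC].
      by rewrite mul1r mulr1.
    rewrite -mulrA xC !mulrA; congr (_ * _); rewrite mulrDl mulrDr mul1r mulr1.
    rewrite /A /B !(extend_funE _ (Ordinal im)) mulrA th0a -!mulrA IH //.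
  have [X QX] := invQ n.+1 (ltn_ord n).
  rewrite -[LHS]mulr1 -[RHS]mulr1 -QX !mulrA; congr (_ * _).
  by rewrite -[LHS]mulrA -QCt mulrA [LHS]alth0 mulrA.
exists th0; split=> // k; exact: (bth0 0).
Qed.

End MulReflect.

Section CenterRelation.
Context {F : fieldType} {N m : nat}.
Local Notation M := 'M[F]_N.+1.

(* The sum (resp. the product) of the tuple is scalar on the center; in the
   multiplicative case the tuple is extended by the identity off the center. *)
Definition center_rel (mul : bool) (E0 : M) (X : 'I_m -> M) : Prop :=
  if mul then exists2 q, q != 0 & \prod_j (1 - E0 + X j) = 1 + (q - 1) *: E0
  else exists t, \sum_j X j = t *: E0.

Lemma prod_corner_scale (E0 : M) (c : 'I_m -> F) (y : 'I_m -> M) :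
  E0 * E0 = E0 -> (forall j, E0 * y j = y j * E0) ->
  \prod_j ((1 + (c j - 1) *: E0) * y j) =
  (1 + (\prod_j c j - 1) *: E0) * \prod_j y j.
Proof.
move=> E00 Ey.
pose K (c : F) (y y' : M) := y' = (1 + (c - 1) *: E0) * y /\ E0 * y = y * E0.
suff [] : K (\prod_j c j) (\prod_j y j) (\prod_j ((1 + (c j - 1) *: E0) * y j)) by [].
apply: (big_ind3 K) => [|c1 y1 z1 c2 y2 z2 [-> E1] [-> E2]|j _].
- by split; rewrite ?mulr1 ?mul1r // subrr scale0r addr0.
- split; last by rewrite mulrA E1 -mulrA E2 mulrA.
  rewrite -corner_scaleM // -!mulrA; congr (_ * _); rewrite !mulrA; congr (_ * _).
  rewrite mulrDl mulrDr mul1r mulr1; congr (_ + _).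
  by rewrite -scalerAl -scalerAr E1.
- by [].
Qed.

Lemma reflects_to_scale E0 (E a b : 'I_m -> M) E0' a' b' (c d : 'I_m -> F) :
  (forall k, c k != 0) -> (forall k, d k != 0) ->
  reflects_to E0 E a (fun k => c k *: b k) E0' a' b' ->
  reflects_to E0 E a b E0' a' (fun k => d k *: b' k).
Proof.
move=> c0 d0 [[E00 rk ha hb] tr]; split.
  by split=> // k; exact: homZ.
move=> th0' th [h0 h ea eb]; have [|[th0 [h0' h' ea' eb']] sc] := tr th0' th.
  by split=> // k; apply: (scalerI (d0 k)); rewrite scalerAl eb -scalerAr.
split=> //; exists th0; split=> // k.
by apply: (scalerI (c0 k)); rewrite scalerAl eb' -scalerAr.
Qed.

(** In the additive case the scalars are gathered into [t = q - \sum_k e k], and [e k] becomes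
    [e k + t]. In the multiplicative case [e k] is factored out of each term by rescaling [b k], and
    [e k] becomes [q1 * e k], where [q1 = q / \prod_k e k]. Either way [b k * a k + e k *: E k] is
    preserved, so the relations further along the arms survive. *)
Lemma center_rel_reflect (mul : bool) (E0 : M) (E a b : 'I_m -> M) (e : 'I_m -> F) :
  E0 * E0 = E0 -> (forall k, E k * E k = E k) ->
  (forall k, hom E0 (E k) (a k)) -> (forall k, hom (E k) E0 (b k)) ->
  (mul -> forall k, e k != 0) ->
  center_rel mul E0 (fun k => a k * b k + e k *: E0) -> vertex_epi E0 b ->
  (\sum_k \rank (E k) <= N.+1 + \rank E0)%N ->
  exists E0' a' b' e',
    [/\ reflects_to E0 E a b E0' a' b',
        center_rel mul E0' (fun k => a' k * b' k + e' k *: E0'),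
        forall k, b' k * a' k + e' k *: E k = b k * a k + e k *: E k
      & mul -> forall k, e' k != 0].
Proof.
case: mul => E00 EE ha hb e0 /= [q]; last first.
  move=> sumX epi bound; pose t := q - \sum_k e k.
  have sum_ab : \sum_k a k * b k = t *: E0.
    by rewrite scalerBl -sumX scaler_suml big_split /= addrK.
  have [E0' [a' [b' [refl ba' ab']]]] := add_reflect E00 EE ha hb sum_ab epi bound.
  exists E0', a', b', (fun k => e k + t); split=> //.
    by exists (- t + \sum_k (e k + t)); rewrite big_split /= ab' -scaler_suml scalerDl.
  by move=> k; rewrite ba' eqxx addrC addrCA scalerDl addrK addrC.
move=> q0 prodX epi bound.
have {}e0 := e0 isT.
have factor (E0' : M) (a' b' : 'I_m -> M) (d : 'I_m -> F) :
    E0' * E0' = E0' -> (forall k, E0' * a' k = a' k) ->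
    (forall k, b' k * E0' = b' k) ->
  \prod_k (1 - E0' + (a' k * (d k *: b' k) + d k *: E0')) =
  (1 + (\prod_k d k - 1) *: E0') * \prod_k (1 + a' k * b' k).
  move=> E00' Ea bE; rewrite -prod_corner_scale //; last first.
    move=> k; rewrite mulrDl mulrDr mul1r mulr1 mulrA Ea; congr (_ + _).
    by rewrite -mulrA bE.
  apply: eq_bigr => k _; rewrite mulrDl mul1r mulrDr mulr1 -!scalerAl mulrA Ea.
  rewrite -scalerAr !scalerBl !scale1r -!addrA; congr (_ + _).
  by rewrite [RHS]addrC -!addrA addNr addr0 [LHS]addrA [LHS]addrC.
pose b1 k := (e k)^-1 *: b k.
have hb1 k : hom (E k) E0 (b1 k) by exact: homZ.
have eprod : \prod_k e k != 0 by apply/prodf_neq0.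
pose q1 := q / \prod_k e k.
have q10 : q1 != 0 by rewrite mulf_neq0 ?invr_eq0.
have prod1 : \prod_k (1 + a k * b1 k) = 1 + (q1 - 1) *: E0.
  have prodE : \prod_k (1 - E0 + (a k * b k + e k *: E0)) =
      (1 + (\prod_k e k - 1) *: E0) * \prod_k (1 + a k * b1 k).
    rewrite -factor //; first last.
    - by move=> k; case: (hb1 k).
    - by move=> k; case: (ha k).
    by apply: eq_bigr => k _; rewrite /b1 scalerA mulfV // scale1r.
  rewrite -[LHS]mul1r -[X in X * _](_ : (1 + ((\prod_k e k)^-1 - 1) *: E0) *
      (1 + (\prod_k e k - 1) *: E0) = _).
    by rewrite -mulrA -prodE prodX corner_scaleM // mulrC.
  by rewrite corner_scaleM // mulVf // subrr scale0r addr0.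
have epi1 : vertex_epi E0 b1.
  move=> f E0f b1f; apply: epi => // k; apply: (scalerI (a := (e k)^-1)).
    by rewrite invr_eq0.
  by rewrite scalerAl b1f scaler0.
have [E0' [a' [b' [refl ba' ab']]]] := mul_reflect E00 EE ha hb1 q10 prod1 epi1 bound.
have d0 k : q1 * e k != 0 by rewrite mulf_neq0.
have [[E00' _ ha' hb'] _] := refl.
exists E0', a', (fun k => (q1 * e k) *: b' k), (fun k => q1 * e k); split=> //.
- by apply: (reflects_to_scale _ d0 refl) => k; rewrite invr_eq0.
- exists ((\prod_k (q1 * e k)) * q1^-1); first by
    rewrite mulf_neq0 ?invr_eq0 //; apply/prodf_neq0.
  rewrite factor //; first last.
  + by move=> k; case: (hb' k).
  + by move=> k; case: (ha' k).
  by rewrite ab' corner_scaleM.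
move=> k; rewrite -scalerAl ba' scalerBr subrK scalerA mulrAC mulfV // mul1r.
by rewrite scalerDr -scalerAl scalerA mulfV // scale1r addrC.
Qed.

End CenterRelation.

(** * Bricks of star-shaped quivers *)

Section StarRepresentations.
Context {F : fieldType} {N m : nat}.
Local Notation M := 'M[F]_N.+1.

(** For the brick of a matrix tuple, both sides of [star_arm] are the restriction of the [j]-th
    matrix to the vertex [i.+1], seen from its two neighbours. The arms are indexed by all of [nat];
    a finite arm is one whose spaces are eventually 0. *)
Record star_rep (mul : bool) (E0 : M) (E a b : 'I_m -> nat -> M)
    (e : 'I_m -> nat -> F) : Prop := StarRep {
  star_idem0 : E0 * E0 = E0;
  star_root : forall j, E j 0%N = E0;
  star_idem : forall j i, E j i * E j i = E j i;
  star_out : forall j i, hom (E j i) (E j i.+1) (a j i);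
  star_in : forall j i, hom (E j i.+1) (E j i) (b j i);
  star_arm : forall j i, b j i * a j i + e j i *: E j i.+1 =
                         a j i.+1 * b j i.+1 + e j i.+1 *: E j i.+1;
  star_center : center_rel mul E0 (fun j => a j 0%N * b j 0%N + e j 0%N *: E0);
  star_unit : mul -> forall j i, e j i != 0 }.

Record star_endo (E0 : M) (E a b : 'I_m -> nat -> M) (th0 : M)
    (th : 'I_m -> nat -> M) : Prop := StarEndo {
  endo_hom0 : hom E0 E0 th0;
  endo_root : forall j, th j 0%N = th0;
  endo_hom : forall j i, hom (E j i) (E j i) (th j i);
  endo_out : forall j i, th j i * a j i = a j i * th j i.+1;
  endo_in : forall j i, b j i * th j i = th j i.+1 * b j i }.

Definition star_brick (E0 : M) (E a b : 'I_m -> nat -> M) : Prop :=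
  forall th0 th, star_endo E0 E a b th0 th ->
    exists c, th0 = c *: E0 /\ forall j i, th j i = c *: E j i.

Definition has_brick (mul : bool) (d0 : nat) (d : 'I_m -> nat -> nat) : Prop :=
  exists E0 E a b e, [/\ star_rep mul E0 E a b e, star_brick E0 E a b,
    \rank E0 = d0 & forall j i, \rank (E j i) = d j i].

Definition set_root (A : Type) (f : 'I_m -> nat -> A) (x : 'I_m -> A) j i : A :=
  if i is _.+1 then f j i else x j.

Lemma center_reflect_epi mul E0 E a b e :
  star_rep mul E0 E a b e -> star_brick E0 E a b ->
  vertex_epi E0 (fun j => b j 0%N) ->
  (\sum_j \rank (E j 1%N) <= N.+1 + \rank E0)%N ->
  exists d0, (d0 + \rank E0 = \sum_j \rank (E j 1%N))%N /\
    has_brick mul d0 (set_root (fun j i => \rank (E j i)) (fun=> d0)).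
Proof.
move=> [E00 Er EE ha hb arm ctr eu] brk epi bound.
have ha0 j : hom E0 (E j 1%N) (a j 0%N) by rewrite -(Er j); exact: ha.
have hb0 j : hom (E j 1%N) E0 (b j 0%N) by rewrite -(Er j); exact: hb.
have [E0' [a' [b' [e' [[[E00' rk ha' hb'] tr] ctr' ba' eu']]]]] :=
  center_rel_reflect E00 (fun j => EE j 1%N) ha0 hb0 (fun h j => eu h j 0%N)
    ctr epi bound.
exists (\rank E0'); split=> //.
exists E0', (set_root E (fun=> E0')), (set_root a a'), (set_root b b'),
  (set_root e e'); split=> // [||j [|i] //].
  split=> //=; do ?[by move=> j [|i] /=].
    by move=> j [|i] /=; rewrite ?ba' arm.
  by move=> h j [|i] /=; [exact: eu'|exact: eu].
move=> th0' th' [h0' r' h' o' i'].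
have [|[th0 [h0 h o i]] sc] := tr th0' (fun j => th' j 1%N).
  split=> // j; first exact: h' j 1%N.
    by rewrite -(r' j); exact: o' j 0%N.
  by rewrite -(r' j); exact: i' j 0%N.
have [|c [th0c thc]] := brk th0 (set_root th' (fun=> th0)).
  split=> //.
  - by move=> j [|k] /=; [rewrite Er|exact: h' j k.+1].
  - by move=> j [|k] /=; [exact: o|exact: o' j k.+1].
  - by move=> j [|k] /=; [exact: i|exact: i' j k.+1].
have thc' j k : th' j k.+1 = c *: E j k.+1 by exact: thc j k.+1.
have th0'c : th0' = c *: E0' by apply: sc => j; exact: thc'.
by exists c; split=> // j [|k]; [rewrite r'|exact: thc'].
Qed.

Section ArmReflection.
Variables (j0 : 'I_m) (i0 : nat).

Definition set_at (A : Type) (f : 'I_m -> nat -> A) i x j k : A :=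
  if (j == j0) && (k == i) then x else f j k.

Lemma set_at_eq A (f : 'I_m -> nat -> A) i x : set_at f i x j0 i = x.
Proof. by rewrite /set_at !eqxx. Qed.

Lemma set_at_neq A (f : 'I_m -> nat -> A) i x j k : k != i ->
  set_at f i x j k = f j k.
Proof. by rewrite /set_at andbC => /negPf ->. Qed.

Definition pair2 (A : Type) (x y : A) (k : 'I_2) : A := if k == ord0 then x else y.

Lemma forall2 (P : 'I_2 -> Prop) : P ord0 -> P (lift ord0 ord0) -> forall k, P k.
Proof.
move=> P0 P1 k; case: (unliftP ord0 k) => [j|] -> //.
by rewrite (ord1 j).
Qed.

(** A vertex inside an arm has two neighbours and its relation is additive whatever [mul] is, so the
    additive reflection applies; a sign on one outgoing map turns the relation into a sum. The
    effect on the parameters is to exchange [e j0 i0] and [e j0 i0.+1]. *)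
Lemma arm_reflect_epi mul E0 E a b e :
  star_rep mul E0 E a b e -> star_brick E0 E a b ->
  vertex_epi (E j0 i0.+1) (pair2 (a j0 i0) (b j0 i0.+1)) ->
  (\rank (E j0 i0) + \rank (E j0 i0.+2) <= N.+1 + \rank (E j0 i0.+1))%N ->
  exists x, (x + \rank (E j0 i0.+1) = \rank (E j0 i0) + \rank (E j0 i0.+2))%N /\
    has_brick mul (\rank E0) (set_at (fun j i => \rank (E j i)) i0.+1 x).
Proof.
move=> [E00 Er EE ha hb arm ctr eu] brk epi bound.
pose EN := pair2 (E j0 i0) (E j0 i0.+2).
pose aN := pair2 (b j0 i0) (- a j0 i0.+1).
pose bN := pair2 (a j0 i0) (b j0 i0.+1).
have EEN k : EN k * EN k = EN k by move: k; apply: forall2; exact: EE.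
have haN k : hom (E j0 i0.+1) (EN k) (aN k).
  by move: k; apply: forall2; [exact: hb|exact/homN/ha].
have hbN k : hom (EN k) (E j0 i0.+1) (bN k).
  by move: k; apply: forall2; [exact: ha|exact: hb].
have sumN : \sum_k aN k * bN k = (e j0 i0.+1 - e j0 i0) *: E j0 i0.+1.
  rewrite big_ord_recl big_ord1 /aN /bN /pair2 /= mulNr scalerBl.
  rewrite -[b j0 i0 * _](addrK (e j0 i0 *: E j0 i0.+1)) arm.
  by rewrite -[X in X - _]addrA addrAC subrr add0r.
have boundN : (\sum_k \rank (EN k) <= N.+1 + \rank (E j0 i0.+1))%N.
  by rewrite big_ord_recl big_ord1.
have [E' [a' [b' [[[E'E' rk ha' hb'] tr] ba' ab']]]] :=
  add_reflect (EE _ _) EEN haN hbN sumN epi boundN.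
rewrite big_ord_recl big_ord1 /EN /pair2 /= in rk.
exists (\rank E'); split=> //.
pose an j i := if j == j0 then
    if i == i0 then b' ord0 else if i == i0.+1 then - a' (lift ord0 ord0) else a j i
  else a j i.
pose bn j i := if j == j0 then
    if i == i0 then a' ord0 else if i == i0.+1 then b' (lift ord0 ord0) else b j i
  else b j i.
pose en j i := if j == j0 then
    if i == i0 then e j i0.+1 else if i == i0.+1 then e j i0 else e j i
  else e j i.
pose En := set_at E i0.+1 E'.
have n1 : (i0 == i0.+1) = false by rewrite ltn_eqF.
have n2 : (i0.+1 == i0) = false by rewrite gtn_eqF.
have n3 : (i0.+2 == i0) = false by rewrite gtn_eqF.
have baO : b' ord0 * a' ord0 + e j0 i0.+1 *: E j0 i0 =
    a j0 i0 * b j0 i0 + e j0 i0 *: E j0 i0.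
  rewrite ba' /bN /aN /EN /pair2 /= scalerBl opprB.
  by rewrite -addrA subrK.
have ba1 : b' (lift ord0 ord0) * - a' (lift ord0 ord0) + e j0 i0 *: E j0 i0.+2 =
    b j0 i0.+1 * a j0 i0.+1 + e j0 i0.+1 *: E j0 i0.+2.
  rewrite mulrN ba' /bN /aN /EN /pair2 /= scalerBl.
  by rewrite mulrN opprB opprK addrAC subrK addrC.
have ab1 : a' ord0 * b' ord0 + e j0 i0.+1 *: E' =
    - a' (lift ord0 ord0) * b' (lift ord0 ord0) + e j0 i0 *: E'.
  move: ab'; rewrite big_ord_recl big_ord1 => /(canRL (addrK _)) ->.
  by rewrite opprB scalerBl mulNr addrAC subrK addrC.
(* The center sees an arm only through this operator, which stays the same even when the reflected
   vertex is adjacent to the center. *)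
have Xn j : an j 0%N * bn j 0%N + en j 0%N *: E0 = a j 0%N * b j 0%N + e j 0%N *: E0.
  rewrite /an /bn /en; case: eqP => // ->; case: eqP => //= z; first last.
  by move: baO; rewrite -z Er.
exists E0, En, an, bn, en; split=> //; last first.
- by move=> j i; rewrite /En /set_at; case: ifP.
- move=> th0' th' [h0' r' h' o' i'].
  have a0 : an j0 i0 = b' ord0 by rewrite /an !eqxx.
  have a1 : an j0 i0.+1 = - a' (lift ord0 ord0) by rewrite /an !eqxx n2.
  have b0 : bn j0 i0 = a' ord0 by rewrite /bn !eqxx.
  have b1 : bn j0 i0.+1 = b' (lift ord0 ord0) by rewrite /bn !eqxx n2.
  have [|[thv [hv hN ov iv]] sc] :=
    tr (th' j0 i0.+1) (pair2 (th' j0 i0) (th' j0 i0.+2)).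
    split.
    - by have := h' j0 i0.+1; rewrite /En set_at_eq.
    - apply: forall2; rewrite /EN /pair2 /=.
        by have := h' j0 i0; rewrite /En set_at_neq ?n1.
      by have := h' j0 i0.+2; rewrite /En set_at_neq // gtn_eqF.
    - apply: forall2; rewrite /pair2 /=; first by rewrite -b0 i'.
      by apply: oppr_inj; rewrite -mulrN -mulNr -a1 o'.
    - by apply: forall2; rewrite /pair2 /=; [rewrite -a0 o'|rewrite -b1 i'].
  have [|c [th0c thc]] := brk th0' (set_at th' i0.+1 thv).
    split=> //.
    - by move=> j; rewrite set_at_neq.
    - move=> j i; have := h' j i; rewrite /En /set_at.
      by case: ifP => // /andP [/eqP -> /eqP ->].
    - move=> j i; have := o' j i; rewrite /an /set_at.
      case: (j =P j0) => [->|_] //=; rewrite eqSS.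
      case: (i =P i0) => [->|_]; first by rewrite n1 => _; have /esym := iv ord0.
      case: (i =P i0.+1) => [->|_] // _.
      by have := ov (lift ord0 ord0); rewrite /aN /pair2 /= mulrN mulNr => /oppr_inj.
    - move=> j i; have := i' j i; rewrite /bn /set_at.
      case: (j =P j0) => [->|_] //=; rewrite eqSS.
      case: (i =P i0) => [->|_]; first by rewrite n1 => _; have /esym := ov ord0.
      by case: (i =P i0.+1) => [->|_] // _; exact: (iv (lift ord0 ord0)).
  have thc' j i : ~~ ((j == j0) && (i == i0.+1)) -> th' j i = c *: E j i.
    by move=> /negPf ne; have := thc j i; rewrite /set_at ne.
  exists c; split=> // j i; rewrite /En /set_at; case: ifP => [|/negbT/thc' //].
  case/andP => /eqP -> /eqP ->; apply: sc; apply: forall2; rewrite /EN /pair2 /=.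
    by rewrite thc' // n1 andbF.
  by rewrite thc' // gtn_eqF // andbF.
split=> //.
- by move=> j; rewrite /En set_at_neq.
- by move=> j i; rewrite /En /set_at; case: ifP.
- move=> j i; rewrite /En /set_at /an; case: eqP => [->|_] /=; last exact: ha.
  rewrite eqSS; case: (i =P i0) => [->|_]; first by rewrite n1; exact: (hb' ord0).
  case: (i =P i0.+1) => [->|_]; last exact: ha.
  exact/homN/(ha' (lift ord0 ord0)).
- move=> j i; rewrite /En /set_at /bn; case: eqP => [->|_] /=; last exact: hb.
  rewrite eqSS; case: (i =P i0) => [->|_]; first by rewrite n1; exact: (ha' ord0).
  case: (i =P i0.+1) => [->|_]; last exact: hb.
  exact: (hb' (lift ord0 ord0)).
- move=> j i; rewrite /En /set_at /an /bn /en; case: eqP => [->|_] /=; last exact: arm.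
  rewrite !eqSS; case: (i =P i0) => [->|_]; first by rewrite n2.
  case: (i =P i0.+1) => [->|_]; first by rewrite n3 ba1 arm.
  case: eqP => [E1|_]; last exact: arm.
  by move: baO; rewrite -E1 => ->; rewrite arm.
- by rewrite (_ : (fun j => _) =
    (fun j => a j 0%N * b j 0%N + e j 0%N *: E0)) //; apply/funext.
- by move=> h j i; rewrite /en; do 3?case: ifP => _; exact: eu.
Qed.

End ArmReflection.
End StarRepresentations.

Arguments has_brick F N {m}.

(** * Transposition of star representations *)

Section Duality.
Context {F : fieldType} {N : nat}.
Local Notation M := 'M[F]_N.+1.

Lemma trmx_mulr (A B : M) : (A * B)^T = B^T * A^T.
Proof. exact: trmx_mul. Qed.

Lemma trmx_prod_rev m (y : 'I_m -> M) :
  (\prod_j y j)^T = \prod_j (y (rev_ord j))^T.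
Proof.
elim: m y => [|m IH] y; first by rewrite !big_ord0; exact: trmx1.
rewrite big_ord_recl big_ord_recr trmx_mulr IH /=; congr (_ * _).
  apply: eq_bigr => j _; congr ((y _)^T); apply: val_inj.
  by rewrite /= /bump leq0n add1n subSS subnSK.
by congr ((y _)^T); apply: val_inj; rewrite /= subnn.
Qed.

Lemma hom_tr (E1 E2 f : M) : hom E1 E2 f -> hom E2^T E1^T f^T.
Proof. by case=> f1 f2; split; rewrite -trmx_mulr ?f1 ?f2. Qed.

Lemma tr_hom (E1 E2 f : M) : hom E1^T E2^T f -> hom E2 E1 f^T.
Proof. by move/hom_tr; rewrite !trmxK. Qed.

Variable (m : nat).

(** Transposing reverses the order of a product, so the arms are listed in reverse order as well. *)
Definition rev_tr (f : 'I_m -> nat -> M) j i : M := (f (rev_ord j) i)^T.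

Lemma center_rel_tr mul (E0 : M) (X : 'I_m -> M) :
  center_rel mul E0 X -> center_rel mul E0^T (fun j => (X (rev_ord j))^T).
Proof.
case: mul => /= [[q q0 prodX]|[t sumX]].
  exists q => //; rewrite -[RHS](_ : (1 + (q - 1) *: E0)^T = _); last first.
    by rewrite linearD /= linearZ /= trmx1.
  rewrite -prodX trmx_prod_rev; apply: eq_bigr => j _.
  by rewrite linearD linearB /= trmx1.
exists t; rewrite -linearZ -sumX linear_sum /=.
by rewrite [RHS](reindex_inj rev_ord_inj).
Qed.

Lemma star_rep_tr mul (E0 : M) E a b (e : 'I_m -> nat -> F) :
  star_rep mul E0 E a b e ->
  star_rep mul E0^T (rev_tr E) (rev_tr b) (rev_tr a) (fun j => e (rev_ord j)).
Proof.
case=> E00 Er EE ha hb arm ctr eu; split.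
- by rewrite -trmx_mulr E00.
- by move=> j; rewrite /rev_tr Er.
- by move=> j i; rewrite -trmx_mulr EE.
- by move=> j i; exact: hom_tr.
- by move=> j i; exact: hom_tr.
- by move=> j i; rewrite -!trmx_mulr -!linearZ /= -!linearD /= arm.
- have := center_rel_tr ctr; congr center_rel; apply/funext => j.
  by rewrite linearD linearZ /= -trmx_mulr.
- by move=> h j i; exact: eu.
Qed.

Lemma star_brick_tr (E0 : M) (E a b : 'I_m -> nat -> M) :
  star_brick E0 E a b -> star_brick E0^T (rev_tr E) (rev_tr b) (rev_tr a).
Proof.
move=> brk th0 th [h0 r h o i].
have [|c [th0c thc]] := brk th0^T (rev_tr th).
  split.
  - exact: tr_hom.
  - by move=> j; rewrite /rev_tr r.
  - by move=> j k; apply: tr_hom; have := h (rev_ord j) k; rewrite /rev_tr rev_ordK.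
  - move=> j k; have := i (rev_ord j) k; rewrite /rev_tr rev_ordK.
    by move/(congr1 trmx); rewrite !trmx_mulr !trmxK.
  - move=> j k; have := o (rev_ord j) k; rewrite /rev_tr rev_ordK.
    by move/(congr1 trmx); rewrite !trmx_mulr !trmxK.
exists c; split; first by rewrite -linearZ /= -th0c trmxK.
move=> j k; have := thc (rev_ord j) k; rewrite /rev_tr rev_ordK.
by move/(congr1 trmx); rewrite linearZ /= trmxK.
Qed.

Lemma has_brick_tr mul d0 (d : 'I_m -> nat -> nat) :
  has_brick F N mul d0 d -> has_brick F N mul d0 (fun j => d (rev_ord j)).
Proof.
case=> E0 [E [a [b [e [rep brk r0 r]]]]].
exists E0^T, (rev_tr E), (rev_tr b), (rev_tr a), (fun j => e (rev_ord j)); split.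
- exact: star_rep_tr.
- exact: star_brick_tr.
- by rewrite mxrank_tr.
- by move=> j i; rewrite mxrank_tr r.
Qed.

(** If both alternatives fail, a column through the cokernel of the incoming maps times a row in the
    common kernel of the outgoing ones is a nonzero endomorphism of rank 1. The rank bound lets the
    caller restrict attention to such maps. *)
Lemma epi_or_mono n (E0 : M) (b a : 'I_n -> M) :
  (forall th : M, hom E0 E0 th -> (forall k, b k * th = 0) ->
     (forall k, th * a k = 0) -> (\rank th <= 1)%N -> th = 0) ->
  vertex_epi E0 b \/ vertex_epi E0^T (fun k => (a k)^T).
Proof.
move=> th0; have [|nepi] := EM (vertex_epi E0 b); [by left|right].
move=> f0 fE fa; apply: contrapT => /eqP f_neq0; apply: nepi => g gE bg.
have fE' : f0^T * E0 = f0^T by rewrite -{2}fE trmx_mulr trmxK.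
have [i [j fij]] : exists i j, f0^T i j != 0.
  apply: contrapT => nex; case/eqP: f_neq0; rewrite -[f0]trmxK.
  suff -> : f0^T = 0 by rewrite trmx0.
  apply/matrixP => i j; rewrite [RHS]mxE; apply: contrapT => /eqP ne.
  by apply: nex; exists i, j.
rewrite mxE in fij; apply/matrixP => k l; rewrite [RHS]mxE.
have /matrixP/(_ k j) : g * delta_mx l i * f0^T = 0.
  apply: th0.
  - by split; rewrite ?mulrA ?gE // -mulrA fE'.
  - by move=> h; rewrite !mulrA bg !mul0r.
  - by move=> h; rewrite -mulrA -(trmxK (a h)) -trmx_mulr fa trmx0 mulr0.
  rewrite (leq_trans (mxrankM_maxl _ _)) // (leq_trans (mxrankM_maxr _ _)) //.
  by rewrite mxrank_delta.
rewrite -[_ * _]/(g *m delta_mx l i *m f0^T) -(mul_delta_mx (0 : 'I_1)).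
rewrite mulmxA -colE -mulmxA -rowE !mxE big_ord1 !mxE => /eqP.
by rewrite mulf_eq0 (negPf fij) orbF => /eqP.
Qed.

End Duality.

(** * Reflections of dimension vectors of bricks *)

Section DimensionVectors.
Context {F : fieldType} {N m : nat}.
Local Notation M := 'M[F]_N.+1.
Variable mul : bool.
Local Notation has_brick := (has_brick F N mul (m := m)).

Lemma has_brick_root d0 d : has_brick d0 d -> forall j, d j 0%N = d0.
Proof. by case=> E0 [E [a [b [e [rep _ <- r]]]]] j; rewrite -r (star_root rep). Qed.

Lemma has_brick_le d0 d : has_brick d0 d -> forall j i, (d j i <= N.+1)%N.
Proof.
by case=> E0 [E [a [b [e [_ _ _ r]]]]] j i; rewrite -r rank_leq_row.
Qed.

Lemma has_brick_center d0 d : has_brick d0 d -> (1 < d0)%N ->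
  (\sum_j d j 1%N <= N.+1 + d0)%N ->
  exists x, (x + d0 = \sum_j d j 1%N)%N /\ has_brick x (set_root d (fun=> x)).
Proof.
move=> hbr; have [E0 [E [a [b [e [rep brk r0 r]]]]]] := hbr => gt1 bound.
have rE : (fun j i => \rank (E j i)) = d.
  by apply/funext => j; apply/funext => i.
have [epi|epi] : vertex_epi E0 (fun j => b j 0%N) \/
    vertex_epi E0^T (fun j => (a j 0%N)^T).
- apply: epi_or_mono => th hth bth tha rk.
  have [|c [thc _]] := brk th (set_root (fun _ _ => 0) (fun=> th)).
    split=> //.
    + move=> j [|i] /=; first by rewrite (star_root rep).
      by split; rewrite ?mulr0 ?mul0r.
    + by move=> j [|i] /=; rewrite ?tha ?mulr0 ?mul0r.
    + by move=> j [|i] /=; rewrite ?bth ?mulr0 ?mul0r.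
  (* A nonzero multiple of [E0] has rank [d0], which exceeds 1, while [th] has rank at most 1. *)
  rewrite thc; have [->|c0] := eqVneq c 0; first by rewrite scale0r.
  by move: rk; rewrite thc mxrank_scale_nz // r0 leqNgt gt1.
- have [|x [xE hx]] := center_reflect_epi rep brk epi.
    by rewrite r0; under eq_bigr do rewrite r.
  by exists x; rewrite rE in hx; split=> //; rewrite -r0 xE; apply: eq_bigr.
(* When the outgoing maps are jointly injective, the transposed representation is reflected and the
   result transposed back. *)
have [||x [xE hx]] := center_reflect_epi (star_rep_tr rep) (star_brick_tr brk).
- move=> f fE af; apply: epi => // j.
  by have := af (rev_ord j); rewrite /rev_tr rev_ordK.
- rewrite mxrank_tr r0 (reindex_inj rev_ord_inj) /=.
  by under eq_bigr do rewrite mxrank_tr rev_ordK r.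
exists x; split.
  rewrite -r0 -mxrank_tr xE (reindex_inj rev_ord_inj) /=.
  by apply: eq_bigr => j _; rewrite mxrank_tr rev_ordK r.
rewrite (_ : set_root d _ = fun j =>
  set_root (fun j i => \rank (rev_tr E j i)) (fun=> x) (rev_ord j)).
  exact: has_brick_tr hx.
apply/funext => j; apply/funext => -[|i] //=.
by rewrite /set_root /rev_tr mxrank_tr rev_ordK r.
Qed.

(** The nonzero dimension at some other vertex forces the scalar of an endomorphism supported at the
    reflected vertex alone to be 0, which is how the alternative of [epi_or_mono] is obtained
    here. *)
Lemma has_brick_arm d0 d j0 i0 : has_brick d0 d ->
  (exists j i, d j i <> 0%N /\ (j <> j0 \/ i <> i0.+1)) ->
  (d j0 i0 + d j0 i0.+2 <= N.+1 + d j0 i0.+1)%N ->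
  exists x, (x + d j0 i0.+1 = d j0 i0 + d j0 i0.+2)%N /\
    has_brick d0 (set_at j0 d i0.+1 x).
Proof.
move=> hbr [j1 [i1 [d1 ne1]]]; have [E0 [E [a [b [e [rep brk r0 r]]]]]] := hbr.
move=> bound.
have rE : (fun j i => \rank (E j i)) = d.
  by apply/funext => j; apply/funext => i.
have [epi|epi] : vertex_epi (E j0 i0.+1) (pair2 (a j0 i0) (b j0 i0.+1)) \/
    vertex_epi (E j0 i0.+1)^T (fun k => (pair2 (b j0 i0) (a j0 i0.+1) k)^T).
- apply: epi_or_mono => th hth bth tha rk.
  have at1 : a j0 i0 * th = 0 := bth ord0.
  have bt1 : b j0 i0.+1 * th = 0 := bth (lift ord0 ord0).
  have tb1 : th * b j0 i0 = 0 := tha ord0.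
  have ta1 : th * a j0 i0.+1 = 0 := tha (lift ord0 ord0).
  have [|c [_ thc]] := brk 0 (set_at j0 (fun _ _ => 0) i0.+1 th).
    split=> //.
    + exact: hom0.
    + by move=> j; rewrite set_at_neq.
    + move=> j i; rewrite /set_at; case: ifP => [/andP [/eqP -> /eqP ->] //|_].
      exact: hom0.
    + move=> j i; rewrite /set_at; case: (j =P j0) => [->|_] /=; last first.
        by rewrite mulr0 mul0r.
      rewrite eqSS; case: (i =P i0) => [->|_].
        by rewrite ltn_eqF //= mul0r at1.
      by case: (i =P i0.+1) => [->|_]; rewrite ?ta1 ?mul0r mulr0.
    + move=> j i; rewrite /set_at; case: (j =P j0) => [->|_] /=; last first.
        by rewrite mulr0 mul0r.
      rewrite eqSS; case: (i =P i0) => [->|_].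
        by rewrite ltn_eqF //= mulr0 tb1.
      by case: (i =P i0.+1) => [->|_]; rewrite ?bt1 ?mulr0 mul0r.
  have := thc j1 i1; rewrite /set_at; case: ifP => [/andP [/eqP jE /eqP iE]|_].
    by case: ne1 => /(_ _).
  move/esym/eqP; rewrite scaler_eq0 => /orP [/eqP c0|/eqP E1].
    by have := thc j0 i0.+1; rewrite /set_at !eqxx c0 scale0r.
  by case: d1; rewrite -r E1 mxrank0.
- have [|x [xE hx]] := arm_reflect_epi rep brk epi; first by rewrite !r.
  by exists x; rewrite !r r0 rE in xE hx *.
have [||x [xE hx]] := arm_reflect_epi (j0 := rev_ord j0) (i0 := i0)
  (star_rep_tr rep) (star_brick_tr brk).
- rewrite /rev_tr rev_ordK => f fE af; apply: epi => //.
  by apply: forall2; [exact: (af ord0)|exact: (af (lift ord0 ord0))].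
- by rewrite /rev_tr !mxrank_tr rev_ordK !r.
rewrite /rev_tr !mxrank_tr rev_ordK !r in xE.
exists x; split=> //; rewrite -r0 -mxrank_tr.
rewrite (_ : set_at j0 d _ _ = fun j => set_at (rev_ord j0)
  (fun j i => \rank (rev_tr E j i)) i0.+1 x (rev_ord j)).
  exact: has_brick_tr hx.
apply/funext => j; apply/funext => i.
by rewrite /set_at /rev_tr mxrank_tr rev_ordK r (inj_eq rev_ord_inj).
Qed.

End DimensionVectors.

(** * Dimension vectors of bricks *)

Lemma geq_tr : transitive geq.
Proof. by move=> y x z; rewrite /geq /= => xy yz; exact: leq_trans yz xy. Qed.

Lemma geq_tot : total geq.
Proof. by move=> x y; exact: leq_total. Qed.

Lemma geq_anti : antisymmetric geq.
Proof. by move=> x y; rewrite andbC; exact: anti_leq. Qed.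

Section BrickDimensions.
Context {F : fieldType} {N m : nat}.
Variable mul : bool.
Local Notation has_brick := (has_brick F N mul (m := m)).

(* If an entry of an arm exceeded its predecessor, reflecting along the arm
   would push a negative difference to its end, where the dimension is 0. *)
Lemma has_brick_arm_noninc d0 d j0 L : has_brick d0 d ->
  (exists j i, d j i <> 0%N /\ (j <> j0 \/ i = 0%N)) ->
  (forall i, (L <= i)%N -> d j0 i = 0%N) ->
  forall k, (d j0 k.+1 <= d j0 k)%N.
Proof.
move=> hd ex dL k; have : (L <= k + L)%N by rewrite leq_addl.
move: {2}L => n; elim: n k d hd ex dL => [|n IH] k d hd ex dL kn.
  by rewrite dL // leqW // -(addn0 k).
rewrite leqNgt; apply/negP => lt.
have kL : (k.+1 < L)%N.
  by rewrite ltnNge; apply/negP => /dL d0'; rewrite d0' in lt.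
have [||x [xE hx]] := has_brick_arm (j0 := j0) (i0 := k) hd.
- have [j [i [dji ne]]] := ex; exists j, i; split=> //.
  by case: ne => [ne|->]; [left|right].
- by have := has_brick_le hd j0 k.+2; lia.
have := IH k.+1 _ hx; rewrite set_at_eq set_at_neq ?gtn_eqF // => H.
suff : (d j0 k.+2 <= x)%N by lia.
apply: H; last by rewrite addSnnS.
  have [j [i [dji ne]]] := ex; exists j, i; split=> //.
  rewrite /set_at; case: ifP => // /andP [/eqP jE /eqP iE].
  by case: ne => // ne; rewrite ne in iE.
move=> i Li; rewrite set_at_neq ?dL // gtn_eqF //.
exact: leq_trans Li.
Qed.

(** If the inequality failed at [j], the reflection at the center would give dimension [x < d j 1],
    so that the arm [j] of the new brick would increase at its first step. *)
Lemma has_brick_beta d0 d : has_brick d0 d -> (1 < d0)%N ->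
  (forall j, d j 1%N < d0)%N ->
  (forall j, exists L, forall i, (L <= i)%N -> d j i = 0%N) ->
  forall j, (d0 <= \sum_(i < m | i != j) d i 1%N)%N.
Proof.
move=> hd gt1 dlt dL j; rewrite leqNgt; apply/negP => lt.
have sumE : (\sum_i d i 1 = d j 1 + \sum_(i < m | i != j) d i 1)%N by rewrite (bigD1 j).
have le0 := has_brick_le hd j 0; rewrite (has_brick_root hd) in le0.
have dj := dlt j.
have [|x [xE hx]] := has_brick_center hd gt1; first by rewrite sumE; lia.
have [L dL'] := dL j.
have := has_brick_arm_noninc (j0 := j) (L := L.+1) hx _ _ 0; rewrite /=.
move=> H; suff : (d j 1 <= x)%N by lia.
apply: H => [|[|i] //= Li]; last by rewrite dL' // ltnW.
(* The monotonicity of the arm requires a nonzero vertex elsewhere: the center if [x] is nonzero,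
   and otherwise another arm, since then the first dimensions sum to [d0] and [d j 1] alone is
   smaller. *)
have [x0|x0] := eqVneq x 0%N; last by exists j, 0%N; split; [exact/eqP|right].
have /existsP [i /andP [ij di]] : [exists i, (i != j) && (d i 1%N != 0%N)].
  apply: contraT => /existsPn nex; suff S0 : (\sum_(i < m | i != j) d i 1 = 0)%N by lia.
  apply: big1 => i ij; apply/eqP; have := nex i; rewrite ij /=.
  by rewrite negbK.
by exists i, 1%N; split; [exact/eqP|left; exact/eqP].
Qed.

(** Insertion sort performed by exchanging adjacent entries only, each exchange being one reflection
    along an arm. *)
Lemma bubble_sort (P : seq nat -> Prop) :
  (forall s1 x y s2, (x <= y)%N -> P (s1 ++ x :: y :: s2) ->
     P (s1 ++ y :: x :: s2)) ->
  forall s, P s -> P (sort geq s).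
Proof.
move=> swap.
have ins s pre x : sorted geq s -> P (pre ++ x :: s) ->
    exists t, [/\ sorted geq t, perm_eq t (x :: s) & P (pre ++ t)].
  elim: s pre => [|y s IH] pre srt Px; first by exists [:: x].
  have [yx|xy] := leqP y x; first by exists (x :: y :: s); split=> //=; rewrite yx.
  have := srt; rewrite /= (path_sortedE geq_tr) => /andP [ys srt'].
  have [|t [st pt Pt]] := IH (rcons pre y) srt'.
    by rewrite cat_rcons; apply: swap => //; exact: ltnW.
  exists (y :: t); split; last by rewrite -cat_rcons.
    by rewrite /= (path_sortedE geq_tr) st (perm_all _ pt) /= ys (ltnW xy).
  by rewrite -(perm_cons y) in pt; rewrite (permPl pt);
    apply: permEl; exact: (perm_catCA [:: y] [:: x]).
move=> s Ps; suff [t [st pt Pt]] : exists t,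
    [/\ sorted geq t, perm_eq t s & P ([::] ++ t)].
  suff -> : sort geq s = t by [].
  apply: (sorted_eq geq_tr geq_anti) => //; first exact: (sort_sorted geq_tot).
  by rewrite perm_sort perm_sym.
rewrite -[s]cat0s in Ps; elim: s [::] Ps => [|x s IH] pre Ps; first by exists [::].
have [|t [st pt Pt]] := IH (rcons pre x); first by rewrite cat_rcons.
rewrite cat_rcons in Pt; have [t' [st' pt' Pt']] := ins _ _ _ st Pt.
by exists t'; split=> //; rewrite (permPl pt') perm_cons.
Qed.

(** The dimensions along an arm whose successive drops are the entries of [s]. Exchanging the
    entries [i] and [i.+1] is the reflection at the vertex [i.+1]. *)
Definition partial_dim (s : seq nat) (i : nat) : nat := sumn (drop i s).

Lemma has_brick_sort d0 (c : 'I_m -> seq nat) : (0 < d0)%N ->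
  has_brick d0 (fun j => partial_dim (c j)) ->
  has_brick d0 (fun j => partial_dim (sort geq (c j))).
Proof.
move=> d0_gt0 hc.
pose cr (r : seq 'I_m) j := if j \in r then sort geq (c j) else c j.
suff H r : has_brick d0 (fun j => partial_dim (cr r j)).
  rewrite (_ : (fun j => _) = (fun j => partial_dim (cr (enum 'I_m) j))) //.
  by apply/funext => j; rewrite /cr mem_enum.
elim: r => [//|j0 r IH].
have [j0r|j0r] := boolP (j0 \in r).
  rewrite (_ : (fun j => _) = (fun j => partial_dim (cr r j))) //.
  by apply/funext => j; rewrite /cr inE; case: eqP => // ->; rewrite j0r.
pose P s := has_brick d0 (fun j => partial_dim (if j == j0 then s else cr r j)).
rewrite (_ : (fun j => _) =
  (fun j => partial_dim (if j == j0 then sort geq (c j0) else cr r j))); last first.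
  by apply/funext => j; rewrite /cr inE; case: eqP => [->|].
apply: (bubble_sort (P := P)) => [s1 x y s2 xy Pxy|]; last first.
  rewrite /P (_ : (fun j => _) = (fun j => partial_dim (cr r j))) //.
  by apply/funext => j; case: eqP => // ->; rewrite /cr (negPf j0r).
have dr k : partial_dim (s1 ++ k) (size s1) = sumn k.
  by rewrite /partial_dim drop_size_cat.
have dr1 k z : partial_dim (s1 ++ z :: k) (size s1).+1 = sumn k.
  by rewrite /partial_dim -cat_rcons drop_size_cat // size_rcons.
have dr2 k z z' : partial_dim (s1 ++ z :: z' :: k) (size s1).+2 = sumn k.
  by rewrite /partial_dim -!cat_rcons drop_size_cat // !size_rcons.
have [||w [wE hw]] := has_brick_arm (j0 := j0) (i0 := size s1) Pxy.
- exists j0, 0%N; rewrite (has_brick_root Pxy); split; last by right.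
  by move=> d00; rewrite d00 in d0_gt0.
- rewrite eqxx dr dr1 dr2 /=; have := has_brick_le Pxy j0 (size s1).
  by rewrite eqxx dr /=; lia.
rewrite /P; move: hw; rewrite (_ : set_at _ _ _ _ =
  (fun j => partial_dim (if j == j0 then s1 ++ y :: x :: s2 else cr r j))) //.
apply/funext => j; apply/funext => i; rewrite /set_at.
case: (j =P j0) => [_|_] //=; case: eqP => [->|/eqP ne].
  by rewrite eqxx dr dr1 dr2 /= in wE; rewrite dr1 /=; lia.
rewrite /partial_dim !drop_cat; case: (ltngtP i (size s1)) => [lt|gt|->].
- by rewrite !sumn_cat /=; lia.
- by have -> : (i - size s1 = (i - (size s1).+2).+2)%N by lia.
- by rewrite subnn /= addnCA.
Qed.
End BrickDimensions.

(** * Columns of Jordan normal forms *)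

Section Columns.
Local Open Scope nat_scope.

(* The partition conjugate to the block sizes, padded with zeros to length L. *)
Definition columns (L : nat) (bs : seq nat) : seq nat :=
  [seq count (ltn l) bs | l <- iota 0 L].

Definition positive_part (s : seq nat) : seq nat := [seq x <- s | 0 < x].
#[global] Arguments positive_part s : simpl never.

Lemma partial_dim_columns L bs i : all (geq L) bs ->
  partial_dim (columns L bs) i = \sum_(b <- bs) (b - i).
Proof.
rewrite /partial_dim /columns -map_drop drop_iota add0n => bsL.
rewrite sumnE big_map; under eq_bigr do rewrite -sum1_count big_mkcond.
rewrite exchange_big /= !big_seq; apply: eq_bigr => b /(allP bsL) /= bL.
rewrite -big_mkcond sum1_count.
have [bi|ib] := leqP b i.
  rewrite (eqP bi); apply/eqP; rewrite -leqn0 leqNgt -has_count -all_predC.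
  apply/allP => l; rewrite mem_iota => /andP [il _] /=.
  by rewrite -leqNgt (leq_trans bi).
have -> : L - i = (b - i) + (L - b) by lia.
rewrite iotaD count_cat (@eq_in_count _ _ predT) => [|l]; last first.
  by rewrite mem_iota subnKC ?(ltnW ib) // => /andP [_ ->].
rewrite count_predT size_iota (@eq_in_count _ _ pred0) ?count_pred0 ?addn0 // => l.
by rewrite mem_iota subnKC ?(ltnW ib) // => /andP [bl _]; rewrite /= ltnNge bl.
Qed.

Lemma partial_dim_positive_part s i :
  partial_dim (sort geq s) i = partial_dim (sort geq (positive_part s)) i.
Proof.
have sumn0 k r : sumn (drop k (nseq r 0)) = 0 by rewrite drop_nseq sumn_nseq.
pose r := count (pred1 0) s.
have -> : sort geq s = sort geq (positive_part s) ++ nseq r 0.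
  apply: (sorted_eq geq_tr geq_anti); first exact: (sort_sorted geq_tot).
    have : all (leq 1) (sort geq (positive_part s)).
      by rewrite all_sort; exact: filter_all.
    have : sorted geq (sort geq (positive_part s)) by exact: (sort_sorted geq_tot).
    have srt0 : sorted geq (nseq r 0) by elim: (r) => [|[|k] IH].
    elim: (sort _ _) => [//|x t IH]; rewrite /= !(path_sortedE geq_tr) all_cat.
    by move=> /andP [-> /IH st] /andP [x0 /st ->]; rewrite all_nseq /= orbT.
  rewrite perm_sort perm_sym; apply/permP => a.
  rewrite count_cat (permP (permEl (perm_sort _ _))) /r count_filter count_nseq.
  elim: s {r} => [|x s IH] /=; first by rewrite muln0.
  by rewrite -IH; case: x => [|x]; case: (a _) => /=; lia.
rewrite /partial_dim drop_cat; case: ltnP => [_|le].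
  by rewrite sumn_cat -[X in nseq X]/r -[nseq r 0]drop0 sumn0 addn0.
by rewrite (drop_oversize le).
Qed.

Lemma partial_dim_perm s t i : perm_eq (positive_part s) (positive_part t) ->
  partial_dim (sort geq s) i = partial_dim (sort geq t) i.
Proof.
move=> st; rewrite partial_dim_positive_part [RHS]partial_dim_positive_part.
have -> // : sort geq (positive_part s) = sort geq (positive_part t).
exact/(perm_sortP geq_tot geq_tr geq_anti).
Qed.

Lemma count_drop_sorted l k t : sorted leq t -> k <= size t ->
  count (ltn l) (drop k t) = minn (count (ltn l) t) (size t - k).
Proof.
elim: t k => [|b t IH] [|k] //=; rewrite (path_sortedE leq_trans) => /andP [bt st] kt.
  rewrite subn0; apply/esym/minn_idPl; have := count_size (ltn l) t.
  by case: (l < b); lia.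
rewrite IH // subSS; have [lb|//] := boolP (l < b).
have -> : count (ltn l) t = size t.
  apply/eqP; rewrite -all_count; apply: sub_all bt => x; exact: leq_trans.
by lia.
Qed.

Lemma count_take_sorted l k t : sorted leq t -> k <= size t ->
  count (ltn l) (take k t) = count (ltn l) t - (size t - k).
Proof.
move=> st kt; have := count_drop_sorted l st kt.
have := count_size (ltn l) (take k t); rewrite size_take_min (minn_idPl kt).
have := count_size (ltn l) (drop k t); rewrite size_drop.
have : count (ltn l) t = count (ltn l) (take k t) + count (ltn l) (drop k t).
  by rewrite -count_cat cat_take_drop.
lia.
Qed.

(** The entry is [c l.+1] as long as [c l.+1 >= k], it is [c l] once [c l < k], and it is [k] at the
    crossing: the first column [c 0] has left and [k] has entered in its place by size. *)
Lemma insert_column (c : nat -> nat) k L :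
  (forall l, c l.+1 <= c l) -> k <= c 0 ->
  perm_eq (rcons [seq minn (c l) k + (c l.+1 - k) | l <- iota 0 L] (minn (c L) k))
          (k :: [seq c l.+1 | l <- iota 0 L]).
Proof.
move=> dec kc0; elim: L => [|L IH]; first by rewrite /= (minn_idPr kc0).
rewrite -{1}addn1 -[in X in _ :: X]addn1 !iotaD !map_cat /= add0n.
rewrite -[X in perm_eq _ (_ :: X)]/([seq c l.+1 | l <- iota 0 L] ++ _) -cat_cons.
rewrite perm_sym; have := IH; rewrite perm_sym => {}IH.
rewrite (perm_trans (_ : perm_eq _ (rcons
  [seq minn (c l) k + (c l.+1 - k) | l <- iota 0 L] (minn (c L) k) ++
  [:: c L.+1]))) ?perm_cat2r //.
rewrite -cats1 -[rcons (_ ++ _) _]cats1 -!catA perm_cat2l /=.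
have dL := dec L; case: (leqP k (c L.+1)) => [kc|ck].
  rewrite (minn_idPr (leq_trans kc dL)) subnKC //.
  by apply: permEl; exact: (perm_catC [:: k] [:: c L.+1]).
by rewrite (eqP (ltnW ck)) addn0.
Qed.

(** Shortening the [k] smallest blocks replaces the first column [size bs] of the conjugate
    partition by [size bs - k]. An entry is added on each side instead of removing one, and zeros
    are discarded because the lengths are padded to [L]. *)
Lemma columns_shrink L k bs : all (leq 1) bs -> all (geq L) bs -> k <= size bs ->
  perm_eq (positive_part (size bs :: columns L (shrink k bs)))
          (positive_part (size bs - k :: columns L bs)).
Proof.
move=> bs1 bsL kbs; pose t := sort leq bs; pose c l := count (ltn l) t.
have st : sorted leq t by apply: sort_sorted; exact: leq_total.
have szt : size t = size bs by rewrite size_sort.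
have cE l : count (ltn l) bs = c l.
  by apply/permP; rewrite perm_sym; apply: permEl; exact: perm_sort.
have c0 : c 0 = size bs by rewrite -cE; apply/eqP; rewrite -all_count.
have cL : c L = 0.
  rewrite -cE; apply/eqP; rewrite -leqn0 leqNgt -has_count -all_predC.
  by apply: sub_all bsL => x /=; rewrite -leqNgt.
have dec l : c l.+1 <= c l by apply: sub_count => x; exact: ltnW.
have colE : columns L (shrink k bs) =
    [seq minn (c l) (size bs - k) + (c l.+1 - (size bs - k)) | l <- iota 0 L].
  apply: eq_map => l; rewrite /shrink count_filter.
  rewrite (eq_count (a2 := ltn l)) => [|x /=]; last first.
    by case: x => [|x] /=; rewrite ?andbF ?andbT.
  rewrite count_cat count_map (eq_count (a1 := preim _ _) (a2 := ltn l.+1));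
    last by case.
  by rewrite count_take_sorted ?count_drop_sorted ?szt // addnC.
have := insert_column L dec (k := size bs - k); rewrite c0 leq_subr cL min0n.
move=> /(_ isT); rewrite -colE -c0 => ins.
have pos0 x : positive_part (rcons x 0) = positive_part x.
  by rewrite /positive_part filter_rcons.
have pos1 x y : positive_part (x :: rcons y 0) = positive_part (x :: y).
  by rewrite -rcons_cons pos0.
have colsE : rcons (columns L bs) 0 = c 0 :: [seq c l.+1 | l <- iota 0 L].
  have -> : columns L bs = [seq c l | l <- iota 0 L] by exact: eq_map.
  rewrite -[X in rcons _ X]cL -map_rcons.
  have <- : iota 0 L.+1 = rcons (iota 0 L) L by rewrite -addn1 iotaD -cats1.
  rewrite /=; congr cons.
  by rewrite -[1]addn0 iotaDl -map_comp.
rewrite -pos1 -[X in perm_eq _ X]pos1 colsE c0; apply: perm_filter.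
rewrite -c0 in ins *; rewrite perm_sym.
apply: perm_trans (_ : perm_eq _ (c 0 :: c 0 - k :: [seq c l.+1 | l <- iota 0 L])) _.
  by apply: permEl; exact: (perm_catCA [:: _] [:: _]).
by rewrite perm_cons perm_sym.
Qed.
End Columns.

Section JordanColumns.
Context {F : fieldType}.
Local Open Scope nat_scope.
Implicit Types J : jnf F.

Definition jcolumns (L : nat) J : seq nat := flatten [seq columns L x.2 | x <- J].

Lemma sumn_columns L bs : all (geq L) bs -> sumn (columns L bs) = sumn bs.
Proof.
move=> bsL; have := partial_dim_columns 0 bsL; rewrite /partial_dim drop0 => ->.
by rewrite sumnE; under eq_bigr do rewrite subn0.
Qed.

Lemma jsizeE J : jsize J = sumn [seq sumn x.2 | x <- J].
Proof.
rewrite /jsize /jblocks; elim: J => [//|x J IH] /=.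
by rewrite map_cat sumn_cat IH -map_comp map_id_in.
Qed.

Lemma sumn_jcolumns L J : (forall x, x \in J -> all (geq L) x.2) ->
  sumn (jcolumns L J) = jsize J.
Proof.
rewrite jsizeE /jcolumns; elim: J => [//|x J IH] H /=.
rewrite sumn_cat sumn_columns ?H ?mem_head // IH // => y yJ.
by apply: H; rewrite inE yJ orbT.
Qed.

Lemma sumn_positive_part s : sumn (positive_part s) = sumn s.
Proof. by elim: s => [//|[|x] s IH] /=; rewrite IH. Qed.

Lemma positive_part_cat s t :
  positive_part (s ++ t) = positive_part s ++ positive_part t.
Proof. exact: filter_cat. Qed.

Lemma count_positive_part_cons a x s : count a (positive_part (x :: s)) =
  ((0 < x) && a x) + count a (positive_part s).
Proof. by rewrite /positive_part /=; case: ifP. Qed.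

Lemma jcolumns_nonempty L J : positive_part (jcolumns L [seq x <- J | x.2 != [::]]) =
  positive_part (jcolumns L J).
Proof.
rewrite /jcolumns; elim: J => [//|[lam [|b bs]] J IH] /=.
  rewrite IH positive_part_cat; suff -> : positive_part (columns L [::]) = [::] by [].
  by rewrite /columns /positive_part /=; elim: (iota _ _).
by rewrite !positive_part_cat IH.
Qed.

Lemma jcolumns_reduce L lam bs k J : uniq [seq x.1 | x <- J] ->
  (forall x, x \in J -> all (leq 1) x.2 && all (geq L) x.2) ->
  (lam, bs) \in J -> k <= size bs ->
  perm_eq (positive_part (size bs :: jcolumns L (jreduce lam k J)))
          (positive_part (size bs - k :: jcolumns L J)).
Proof.
move=> uJ HJ inJ kbs; rewrite /jreduce.
rewrite -[size bs :: _]cat1s positive_part_cat jcolumns_nonempty.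
rewrite -positive_part_cat cat1s.
elim: J uJ HJ inJ => [//|x J IH] /= /andP [xJ uJ] HJ.
have [Hx HJ'] : all (leq 1) x.2 && all (geq L) x.2 /\
    (forall y, y \in J -> all (leq 1) y.2 && all (geq L) y.2).
  by split=> [|y yJ]; apply: HJ; rewrite inE ?eqxx ?yJ ?orbT.
rewrite /jcolumns /= -/(jcolumns L J) inE => /orP [/eqP xE|inJ].
  rewrite -xE /= eqxx /= (_ : [seq _ | y <- J] = J); last first.
    rewrite -[RHS]map_id; apply/eq_in_map => y yJ; case: eqP => // ylam.
    by case/negP: xJ; rewrite -xE /= -ylam; exact: (map_f fst yJ).
  move: Hx; rewrite -xE => /andP [/= b1 bL].
  rewrite -!cat_cons !positive_part_cat perm_cat2r; exact: columns_shrink.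
have -> /= : (x.1 == lam) = false.
  by apply/eqP => xl; case/negP: xJ; rewrite xl; apply: (map_f fst inJ).
have := IH uJ HJ' inJ; rewrite -/(jcolumns L _) => {}IH.
apply/permP => a; move/permP/(_ a): IH.
rewrite !(count_positive_part_cons, positive_part_cat, count_cat).
by rewrite addnCA => ->; rewrite addnCA.
Qed.

(** The columns of an eigenvalue are bounded by its first one, the number of its blocks, so the
    eigenvalue with most blocks owns the largest column of all. *)
Lemma jcolumns_max L lam bs J :
  (forall x, x \in J -> all (leq 1) x.2 && all (geq L) x.2) ->
  (lam, bs) \in J -> bs != [::] -> (forall x, x \in J -> size x.2 <= size bs) ->
  exists rest, [/\ perm_eq (jcolumns L J) (size bs :: rest),
    sort geq (jcolumns L J) = size bs :: sort geq rest &
    size bs + sumn rest = jsize J].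
Proof.
move=> HJ inJ bs0 maxbs.
have [b1 bL] := andP (HJ _ inJ).
have L0 : 0 < L.
  case: bs bs0 b1 bL {inJ maxbs} => [//|b bs] _ /=.
  by move=> /andP [b1 _] /andP [/(leq_trans b1)].
have szcol : size bs \in jcolumns L J.
  apply/flattenP; exists (columns L bs); first by apply/mapP; exists (lam, bs).
  rewrite /columns; case: (L) L0 => // L' _; rewrite /= inE; apply/orP; left.
  by rewrite eq_sym -all_count.
have perm := perm_to_rem szcol; exists (rem (size bs) (jcolumns L J)); split=> //.
- apply: (sorted_eq geq_tr geq_anti); first exact: (sort_sorted geq_tot).
    rewrite /= (path_sortedE geq_tr) (sort_sorted geq_tot) andbT all_sort.
    apply/allP => c /mem_rem /flattenP [cs /mapP [x xJ ->]] /mapP [l _ ->] /=.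
    by rewrite (leq_trans (count_size _ _)) // maxbs.
  by rewrite perm_sort (permPl perm) perm_cons perm_sym perm_sort.
- rewrite -(sumn_jcolumns (L := L)) => [|x /HJ /andP [] //].
  by rewrite (perm_sumn perm).
Qed.

Lemma partial_dim_jreduce L lam bs k J rest : uniq [seq x.1 | x <- J] ->
  (forall x, x \in J -> all (leq 1) x.2 && all (geq L) x.2) ->
  (lam, bs) \in J -> k <= size bs -> perm_eq (jcolumns L J) (size bs :: rest) ->
  forall i, partial_dim (sort geq (jcolumns L (jreduce lam k J))) i =
    partial_dim (sort geq (size bs - k :: sort geq rest)) i.
Proof.
move=> uJ HJ inJ kbs pJ i; apply: partial_dim_perm.
have := jcolumns_reduce uJ HJ inJ kbs.
move=> red.
have {}pJ : perm_eq (positive_part (jcolumns L J))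
    (positive_part (size bs :: sort geq rest)).
  by apply: perm_filter; rewrite (permPl pJ) perm_cons perm_sym perm_sort.
apply/permP => a; move/permP/(_ a): red; move/permP/(_ a): pJ.
by rewrite !count_positive_part_cons => ->; rewrite addnCA => /addnI.
Qed.

Lemma jreduce_jnf L n lam bs k J : is_jnf n J ->
  (forall x, x \in J -> all (geq L) x.2) -> (lam, bs) \in J -> k <= size bs ->
  is_jnf (n - k) (jreduce lam k J) /\
  (forall x, x \in jreduce lam k J -> all (geq L) x.2).
Proof.
move=> [uJ HJ szJ] HL inJ kbs.
have Hall x : x \in J -> all (leq 1) x.2 && all (geq L) x.2.
  by move=> xJ; rewrite HL // andbT; case: (HJ x xJ).
have HL' x : x \in jreduce lam k J -> all (geq L) x.2.
  rewrite mem_filter => /andP [_ /mapP [y yJ ->]]; have [y1 yL] := andP (Hall y yJ).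
  case: ifP => //= _; apply/allP => c; rewrite mem_filter mem_cat => /andP [_].
  have memt z : z \in sort leq y.2 -> geq L z by rewrite mem_sort => /(allP yL).
  case/orP => [/mapP [z /mem_take /memt zL ->]|/mem_drop /memt //].
  by rewrite /= (leq_trans (leq_pred _)).
split=> //; split.
- have : uniq [seq x.1 | x <-
      [seq (if x.1 == lam then (x.1, shrink k x.2) else x) | x <- J]].
    by rewrite -map_comp (eq_map (g := fst)) // => x /=; case: ifP.
  by apply: subseq_uniq; apply: map_subseq; exact: filter_subseq.
- move=> x; rewrite mem_filter => /andP [x0 /mapP [y yJ xE]]; split=> //.
  rewrite xE; case: ifP => /= _; first exact: filter_all.
  by case: (HJ y yJ).
- have /perm_sumn := jcolumns_reduce uJ Hall inJ kbs.
  rewrite !sumn_positive_part /= !sumn_jcolumns // szJ.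
  have : k <= n.
    rewrite -szJ jsizeE (leq_trans kbs) //.
    have [b1 _] := andP (Hall _ inJ).
    have : size bs <= sumn bs.
      by elim: (bs) b1 => [//|b s IH] /= /andP [b1 /IH le]; rewrite -add1n leq_add.
    move/leq_trans; apply; have := map_f (fun x => sumn x.2) inJ.
    by move/perm_to_rem/perm_sumn => ->; rewrite /= leq_addr.
  move=> kn H; apply/eqP; rewrite -(eqn_add2l (size bs)) H.
  by rewrite addnBAC // addnBA.
Qed.
End JordanColumns.

(** * Ranks of products of shifted Jordan matrices *)

Section JordanRank.
Context {F : fieldType}.

Definition eigen_prod n (es : seq F) (A : 'M[F]_n) : 'M[F]_n :=
  \prod_(e <- es) (A - e%:M).

Lemma eigen_prod_block n1 n2 es (A : 'M[F]_n1) (B : 'M[F]_n2) :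
  eigen_prod es (block_mx A 0 0 B) =
  block_mx (eigen_prod es A) 0 0 (eigen_prod es B).
Proof.
rewrite /eigen_prod; elim: es => [|e es IH].
  by rewrite !big_nil -[RHS]scalar_mx_block.
rewrite !big_cons IH scalar_mx_block opp_block_mx add_block_mx !oppr0 !addr0.
by apply: etrans (mulmx_block _ _ _ _ _ _ _ _) _; rewrite !mulmx0 !mul0mx !addr0 !add0r.
Qed.

Definition shift_mx b c : 'M[F]_b := \matrix_(i, j) ((j : nat) == (i + c)%N)%:R.

Lemma shift_mx0 b : shift_mx b 0 = 1%:M.
Proof. by apply/matrixP => i j; rewrite !mxE addn0 eq_sym. Qed.

Lemma shift_mxS b c : shift_mx b 1 *m shift_mx b c = shift_mx b c.+1.
Proof.
apply/matrixP => i j; rewrite !mxE; under eq_bigr do rewrite !mxE.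
have [ib|ib] := ltnP i.+1 b.
  rewrite (bigD1 (Ordinal ib)) //= addn1 eqxx mul1r big1 ?addr0 => [|k /negPf kn].
    by rewrite addSnnS.
  by rewrite (_ : (k : nat) == i.+1 = false) ?mul0r // -[RHS]kn.
rewrite big1 => [|k _].
  by rewrite ltn_eqF // (leq_trans (ltn_ord j)) // (leq_trans ib) //
      addnS ltnS leq_addr.
by rewrite ltn_eqF ?mul0r // (leq_trans (ltn_ord k)) // addn1.
Qed.

Lemma rank_shift_mx b c : \rank (shift_mx b c) = (b - c)%N.
Proof.
have pidS : pid_mx (b - c) *m shift_mx b c = shift_mx b c.
  apply/matrixP => i j; rewrite mxE (bigD1 i) //= !mxE eqxx /= big1 => [|k ki].
    rewrite addr0; case: ltnP => [_|ic]; first by rewrite mul1r.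
    by rewrite mul0r ltn_eqF // (leq_trans (ltn_ord j)) // addnC -leq_subLR.
  by rewrite mxE [(i : nat) == k]eq_sym (inj_eq val_inj) (negPf ki) mul0r.
have Spid : shift_mx b c *m (shift_mx b c)^T = pid_mx (b - c).
  apply/matrixP => i j; rewrite !mxE; under eq_bigr do rewrite !mxE.
  have [ib|ib] := ltnP (i + c) b.
    rewrite (bigD1 (Ordinal ib)) //= eqxx mul1r big1 ?addr0 => [|k /negPf kn].
      by rewrite eqn_add2r ltn_subRL addnC ib andbT.
    by rewrite (_ : (k : nat) == (i + c)%N = false) ?mul0r // -[RHS]kn.
  rewrite big1 => [|k _]; first by rewrite ltn_subRL addnC ltnNge ib andbF.
  by rewrite ltn_eqF ?mul0r // (leq_trans (ltn_ord k)).
have rp : \rank (pid_mx (b - c) : 'M[F]_b) = (b - c)%N.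
  by rewrite rank_pid_mx // leq_subr.
apply/eqP; rewrite eqn_leq; apply/andP; split.
  by rewrite -pidS -[X in (_ <= X)%N]rp mxrankM_maxl.
by rewrite -[X in (X <= _)%N]rp -Spid mxrankM_maxl.
Qed.

Lemma jordan_blockB lam b e :
  jordan_block lam b - e%:M = (lam - e)%:M + shift_mx b 1 :> 'M[F]_b.
Proof.
apply/matrixP => i j; rewrite !mxE addn1 eq_sym.
have [->|ij] := eqVneq i j; first by rewrite ltn_eqF ?ltnSn // addr0 !mulr1n.
by rewrite !mulr0n subr0 add0r.
Qed.

(** Factors with [e != lam] are invertible and commute with the nilpotent shift, and each factor
    with [e = lam] is the shift itself. The product is therefore a unit times a power of the
    shift. *)
Lemma rank_eigen_prod_block es lam b :
  \rank (eigen_prod es (jordan_block lam b)) = (b - count_mem lam es)%N.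
Proof.
pose S1 := shift_mx b 1.
suff [U [uU US ->]] : exists U : 'M[F]_b, [/\ U \in unitmx, U *m S1 = S1 *m U &
    eigen_prod es (jordan_block lam b) = U *m shift_mx b (count_mem lam es)].
  by rewrite eqmxMfull ?row_full_unit // rank_shift_mx.
have scalarC c : c%:M *m S1 = S1 *m c%:M by rewrite scalar_mxC.
elim: es => [|e es [U [uU US IH]]].
  exists 1%:M; rewrite unitmx1 mul1mx mulmx1 shift_mx0 /eigen_prod big_nil.
  by rewrite mul1mx.
rewrite /eigen_prod big_cons -[\prod_(_ <- es) _]/(eigen_prod es _) IH.
rewrite -[_ * _]/(_ *m (U *m _)) jordan_blockB /= mulmxA.
have [->|el] := eqVneq e lam.
  exists U; split=> //.
  by rewrite subrr raddf0 add0r -US -mulmxA shift_mxS add1n.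
exists (((lam - e)%:M + S1) *m U); split; last by rewrite add0n.
- rewrite unitmx_mul uU andbT -unitmx_tr unitmxE det_trig.
    rewrite unitfE; apply/prodf_neq0 => i _; rewrite !mxE eqxx mulr1n addn1.
    by rewrite ltn_eqF // addr0 subr_eq0 eq_sym.
  apply/is_trig_mxP => i j ij; rewrite !mxE [j == i]gtn_eqF // add0r.
  by rewrite ltn_eqF // addn1 ltnS ltnW.
- by rewrite -mulmxA US !mulmxA mulmxDl mulmxDr scalarC.
Qed.

Lemma rank_eigen_prod_diag es (s : seq (F * nat)) :
  \rank (eigen_prod es (jordan_diag s)) =
  (\sum_(x <- s) (x.2 - count_mem x.1 es))%N.
Proof.
elim: s => [|x s IH]; first by rewrite big_nil (flatmx0 (eigen_prod _ _)) mxrank0.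
by rewrite big_cons -IH -rank_eigen_prod_block -rank_diag_block_mx -eigen_prod_block.
Qed.

Lemma rank_jordan_sub (J : jnf F) (mu : F) :
  (forall x, x \in J -> all (leq 1) x.2) ->
  (\rank (jordan_mx J - mu%:M)%R +
    \sum_(x <- J) (if x.1 == mu then size x.2 else 0) = jsize J)%N.
Proof.
move=> HJ; have := rank_eigen_prod_diag [:: mu] (jblocks J).
rewrite /eigen_prod big_seq1 => ->.
rewrite jsizeE /jblocks sumnE big_map big_flatten /= big_map -big_split /=.
apply: eq_big_seq => x xJ; rewrite big_map /=.
have := HJ x xJ; elim: x.2 => [|b s IH] /=; first by rewrite big_nil; case: ifP.
move=> /andP [b1 /IH <-]; rewrite big_cons /= addn0 eq_sym.
by case: (x.1 == mu); lia.
Qed.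

(** Subtracting [mu] loses one rank for each block with eigenvalue [mu]. As eigenvalues are
    distinct, this loss is at most [size bs], with equality at [lam]. *)
Lemma jrank_jsize (J : jnf F) lam (bs : seq nat) : uniq [seq x.1 | x <- J] ->
  (forall x, x \in J -> all (leq 1) x.2) -> (lam, bs) \in J ->
  (forall x, x \in J -> (size x.2 <= size bs)%N) ->
  (jrank J + size bs = jsize J)%N.
Proof.
move=> uJ HJ inJ maxJ.
have sum_le mu : (\sum_(x <- J) (if x.1 == mu then size x.2 else 0) <= size bs)%N.
  elim: J uJ maxJ {HJ inJ} => [|x J IH] /=; first by rewrite big_nil.
  move=> /andP [xJ uJ] maxJ; rewrite big_cons.
  case: eqP => [xmu|_]; last first.
    by apply: IH => // y yJ; apply: maxJ; rewrite inE yJ orbT.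
  rewrite big1_seq ?addn0 ?maxJ ?mem_head // => y /= yJ; case: eqP => // ymu.
  by case/negP: xJ; rewrite xmu -ymu map_f.
have sum_lam : (\sum_(x <- J) (if x.1 == lam then size x.2 else 0) = size bs)%N.
  apply/eqP; rewrite eqn_leq sum_le (big_rem _ inJ) /= eqxx leq_addr //.
rewrite /jrank /min_rank_shift; case: ex_minnP => k /asboolP [mu muk] min.
apply/eqP; rewrite eqn_leq; apply/andP; split.
  rewrite -(rank_jordan_sub lam HJ) sum_lam leq_add2r; apply: min; apply/asboolP.
  by exists lam.
by rewrite -(rank_jordan_sub mu HJ) muk leq_add2l.
Qed.

(** Each eigenvalue is listed [L] times, at least as often as its largest block requires. The first
    [i] factors thus exhaust some eigenvalues completely and shorten the blocks of the next one,
    which amounts to dropping [i] columns of the concatenated list. *)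
Lemma sum_eigen_columns L (J : jnf F) i : uniq [seq x.1 | x <- J] ->
  (forall x, x \in J -> all (geq L) x.2) ->
  (\sum_(x <- jblocks J)
     (x.2 - count_mem x.1 (take i (flatten [seq nseq L y.1 | y <- J]))) =
   partial_dim (jcolumns L J) i)%N.
Proof.
elim: J i => [|x J IH] i /=; first by rewrite big_nil.
move=> /andP [xJ uJ] HL.
have HLJ y : y \in J -> all (geq L) y.2 by move=> yJ; apply: HL; rewrite inE yJ orbT.
have xL := HL x (mem_head _ _).
have szc : size (columns L x.2) = L by rewrite size_map size_iota.
rewrite /jblocks /= big_cat /= big_map /= /partial_dim /jcolumns /= take_cat drop_cat.
rewrite size_nseq szc; case: ltnP => iL.
  rewrite sumn_cat -[sumn (drop i _)]/(partial_dim _ i) partial_dim_columns //.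
  rewrite take_nseq ?(ltnW iL) //; congr addn.
    by apply: eq_bigr => b _; rewrite count_nseq /= eqxx mul1n.
  rewrite -[sumn _]/(sumn (jcolumns L J)) sumn_jcolumns //.
  rewrite jsizeE sumnE big_map big_flatten /= big_map.
  apply: eq_big_seq => y yJ; rewrite big_map sumnE; apply: eq_bigr => b _ /=.
  rewrite count_nseq /= (_ : (x.1 == y.1) = false) ?mul0n ?subn0 //.
  by apply/eqP => xy; case/negP: xJ; rewrite xy map_f.
rewrite -[RHS]IH // -[RHS]add0n; congr addn.
  rewrite big_seq big1 // => b /(allP xL) /= bL; apply/eqP.
  by rewrite subn_eq0 count_cat count_nseq /= eqxx mul1n (leq_trans bL) ?leq_addr.
rewrite !big_flatten /= !big_map; apply: eq_big_seq => y yJ.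
rewrite !big_map; apply: eq_bigr => b _ /=; rewrite count_cat count_nseq /=.
rewrite (_ : (x.1 == y.1) = false) ?mul0n ?add0n //.
by apply/eqP => xy; case/negP: xJ; rewrite xy map_f.
Qed.
End JordanRank.

(** * From tuples of matrices to bricks *)

Section InitialBrick.
Context {F : fieldType} {N m : nat}.
Local Notation M := 'M[F]_N.+1.
Variables (mul : bool) (A : 'I_m -> M) (e : 'I_m -> nat -> F).
Hypotheses (ctr : center_rel mul 1 A) (e0 : mul -> forall j i, e j i != 0)
  (triv : forall B : M, (forall j, B * A j = A j * B) -> exists c, B = c *: 1).

Let P j i : M := eigen_prod (mkseq (e j) i) (A j).
Let E j i : M := pinvmx (P j i) *m P j i.
Let B j i : M := A j - e j i *: 1.

Let P0 j : P j 0 = 1.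
Proof. by rewrite /P /eigen_prod big_nil. Qed.

Let PSr j i : P j i.+1 = P j i * B j i.
Proof. by rewrite /P /eigen_prod mkseqS big_rcons /B -[1]/(1%:M) scalemx1. Qed.

Let PB j i k : P j i * B j k = B j k * P j i.
Proof.
elim: i => [|i IH]; first by rewrite P0 mul1r mulr1.
rewrite PSr -mulrA [B j i * B j k](_ : _ = B j k * B j i).
  by rewrite mulrA IH mulrA.
have AB : A j * B j k = B j k * A j.
  by rewrite /B mulrBl mulrBr -scalerAl -scalerAr mul1r mulr1.
move: AB; generalize (B j k) => X AB; rewrite /B mulrBl mulrBr AB.
by rewrite -scalerAl -scalerAr mul1r mulr1.
Qed.

Let Efix j i x (X : 'M_(x, N.+1)) : (X <= P j i)%MS -> X *m E j i = X.
Proof. by move=> XP; rewrite mulmxA mulmxKpV. Qed.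

Let EP j i : (E j i <= P j i)%MS. Proof. exact: submxMl. Qed.

Let EE j i : E j i * E j i = E j i. Proof. exact: Efix. Qed.

Let E0 j : E j 0 = 1.
Proof. by rewrite -[LHS]mul1r; apply: Efix; rewrite P0. Qed.

Let EB j i : E j i * B j i * E j i.+1 = E j i * B j i.
Proof.
apply: Efix; rewrite PSr -[_ * B j i]/(_ *m B j i) -[X in (_ <= X)%MS]/(P j i *m B j i).
exact: submxMr.
Qed.

Let EB1 j : B j 0 * E j 1 = B j 0.
Proof. by have := EB j 0; rewrite E0 !mul1r. Qed.

Let ES j i : E j i.+1 * E j i = E j i.+1.
Proof. by apply: Efix; rewrite (submx_trans (EP _ _)) // PSr PB submxMl. Qed.

Let EA j i : E j i * B j i + e j i *: E j i = E j i * A j.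
Proof. by rewrite /B mulrBr -scalerAr mulr1 subrK. Qed.

(** [E j i] projects onto the row space of [P j i], that is, the [i]-th image along the arm.
    Outgoing maps apply [A j - e j i] and incoming maps are inclusions, so an endomorphism is the
    restriction of its value at the center, which commutes with all [A j] and hence is scalar. *)
Lemma initial_brick :
  has_brick F N mul N.+1 (fun j i => \rank (eigen_prod (mkseq (e j) i) (A j))).
Proof.
exists 1, E, (fun j i => E j i * B j i), (fun j i => E j i.+1), e; split.
- split=> //.
  + by rewrite mulr1.
  + by move=> j i; split; rewrite ?EB // mulrA EE.
  + move=> j i; rewrite EB EA mulrA ES.
    by rewrite -EA /B !mulrBr -!scalerAr !mulr1 !subrK.
  + rewrite (_ : (fun j => _) = A) //; apply/funext => j.
    by rewrite EB -(E0 j) EA E0 mul1r.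
- move=> th0 th [_ r h o i].
  have thE j k : th j k = E j k * th0.
    elim: k => [|k IH]; first by rewrite r E0 mul1r.
    by rewrite -(h j k.+1).2 -i IH mulrA ES.
  have [|c th0c] := triv (B := th0).
    move=> j; have := o j 0; rewrite !thE E0 !mul1r mulrA EB1.
    by rewrite /B mulrBl mulrBr -scalerAl -scalerAr mul1r mulr1 => /addIr.
  exists c; split=> // j k; rewrite thE th0c -scalerAr mulr1 //.
- by rewrite mxrank1.
- move=> j i; apply/eqP; rewrite eqn_leq; apply/andP; split; apply: mxrankS => //.
  by rewrite -[X in (X <= _)%MS](Efix (submx_refl _)) submxMl.
Qed.
End InitialBrick.

(** * The reduction procedure on bricks *)

Section JordanReduction.
Context {F : fieldType} {N p : nat}.
Local Open Scope nat_scope.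
Variables (mul : bool) (L : nat).

Definition jdims (J : jnf F) : nat -> nat := partial_dim (sort geq (jcolumns L J)).

Record jbrick (n : nat) (J : 'I_p.+1 -> jnf F) : Prop := JBrick {
  jbrick_gt0 : 0 < n;
  jbrick_jnf : forall j, is_jnf n (J j);
  jbrick_bound : forall j x, x \in J j -> all (geq L) x.2;
  jbrick_dims : has_brick F N mul n (fun j => jdims (J j)) }.

Lemma jdims_max n (J : jnf F) lam (bs : seq nat) : is_jnf n J ->
  (forall x, x \in J -> all (geq L) x.2) -> (lam, bs) \in J ->
  (forall x, x \in J -> size x.2 <= size bs) ->
  exists rest, [/\ perm_eq (jcolumns L J) (size bs :: rest),
    sort geq (jcolumns L J) = size bs :: sort geq rest,
    size bs + jrank J = n, sumn rest = jrank J & 0 < size bs].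
Proof.
move=> [uJ HJ szJ] HL inJ maxJ.
have [bs0 b1] := HJ _ inJ.
have [|rest [pJ sJ sumJ]] := jcolumns_max _ inJ bs0 maxJ (L := L).
  by move=> x xJ; rewrite HL // andbT; case: (HJ x xJ).
have rk := jrank_jsize uJ (fun x xJ => (HJ x xJ).2) inJ maxJ.
exists rest; split=> //; first by rewrite addnC rk.
  by apply/eqP; rewrite -(eqn_add2l (size bs)) sumJ -rk addnC.
by case: (bs) bs0.
Qed.

Lemma jnf_max n (J : jnf F) : is_jnf n J -> 0 < n -> exists lam (bs : seq nat),
  (lam, bs) \in J /\ forall x, x \in J -> size x.2 <= size bs.
Proof.
move=> [_ _ szJ] n0; have : J != [::] by case: J szJ n0 => //= <-.
elim: J {szJ} => [//|x J IH] _; have [J0|J0] := eqVneq J [::].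
  exists x.1, x.2; rewrite J0; split; first by rewrite -surjective_pairing mem_head.
  by move=> y; rewrite inE => /eqP ->.
have [lam [bs [inJ maxJ]]] := IH J0.
have [le|lt] := leqP (size x.2) (size bs).
  exists lam, bs; split; first by rewrite inE inJ orbT.
  by move=> y; rewrite inE => /orP [/eqP -> //|]; exact: maxJ.
exists x.1, x.2; split; first by rewrite -surjective_pairing mem_head.
move=> y; rewrite inE => /orP [/eqP -> //|/maxJ le].
exact: leq_trans le (ltnW lt).
Qed.

(** The first vertex of the arm has dimension [n] minus the largest column, and that column is the
    largest number of blocks of an eigenvalue. *)
Lemma jdims1 n (J : jnf F) : 0 < n -> is_jnf n J ->
  (forall x, x \in J -> all (geq L) x.2) -> jdims J 1 = jrank J /\ jrank J < n.
Proof.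
move=> n0 jJ HL; have [lam [bs [inJ maxJ]]] := jnf_max jJ n0.
have [rest [_ sJ sz sr bs0]] := jdims_max jJ HL inJ maxJ.
split; last by rewrite -sz -[X in X < _]add0n ltn_add2r.
by rewrite /jdims /partial_dim sJ /= drop0 -sr; apply/perm_sumn; rewrite perm_sort.
Qed.

Lemma jbrick_beta n (J : 'I_p.+1 -> jnf F) : jbrick n J -> 1 < n -> beta n J.
Proof.
move=> [n0 jJ HL hb] n1 j.
have d1 i := jdims1 n0 (jJ i) (HL i).
rewrite (eq_bigr (fun i => jdims (J i) 1)) => [|i _]; last by rewrite (d1 i).1.
apply: (has_brick_beta hb n1) => i; first by rewrite (d1 i).1 (d1 i).2.
exists (size (sort geq (jcolumns L (J i)))) => k le.
by rewrite /jdims /partial_dim drop_oversize.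
Qed.

Lemma jbrick_step n (J : 'I_p.+1 -> jnf F) n' J' : jbrick n J -> ~ stops n J ->
  n' = \sum_(j < p.+1) jrank (J j) - n ->
  (forall j, jstep (n - n') (J j) (J' j)) -> jbrick n' J'.
Proof.
move=> hJ nst n'E step; have [n0 jJ HL hb] := hJ.
have n1 : 1 < n.
  by rewrite ltn_neqAle n0 andbT; apply/eqP => n1; apply: nst; apply: Or33.
have bt : beta n J by apply: jbrick_beta.
have nom : \sum_(j < p.+1) jrank (J j) < 2 * n.
  by rewrite ltnNge; apply/negP => om; apply: nst; apply: Or31.
have d1 i := jdims1 n0 (jJ i) (HL i).
have sumE j : \sum_(i < p.+1) jrank (J i) =
    jrank (J j) + \sum_(i < p.+1 | i != j) jrank (J i) by rewrite (bigD1 j).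
have rn' j : jrank (J j) <= n' by have := bt j; rewrite n'E (sumE j); lia.
have nN : n <= N.+1.
  by have := has_brick_le hb ord0 0; rewrite (has_brick_root hb).
have sumd : \sum_j jdims (J j) 1 = \sum_(j < p.+1) jrank (J j).
  by apply: eq_bigr => j _; exact: (d1 j).1.
have [|x [xE hx]] := has_brick_center hb n1; first by rewrite sumd; lia.
have {xE} xE : x = n' by rewrite n'E -sumd -xE addnK.
rewrite {}xE in hx.
(* Every [jrank (J j)] is at most [n']; were [n'] zero, [beta] would give [n <= 0]. *)
have n'0 : 0 < n'.
  rewrite lt0n; apply/eqP => n'0; have := bt ord0; rewrite big1 => [|i _].
    by rewrite leqNgt n0.
  by apply/eqP; rewrite -leqn0 -n'0.
have n'n : n' <= n by rewrite n'E; lia.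
pose s j := sort geq (jcolumns L (J j)).
(* The columns after the reflection at the center: only the largest one changes. Its subtraction is
   not truncated, because [jrank (J j) <= n'] means [n - n' <= size bs]. *)
pose c j := (head 0 (s j) - (n - n')) :: behead (s j).
have cE j : [/\ is_jnf n' (J' j), forall x, x \in J' j -> all (geq L) x.2,
    forall i, partial_dim (c j) i = set_root (fun j => jdims (J j)) (fun=> n') j i &
    forall i, jdims (J' j) i = partial_dim (sort geq (c j)) i].
  have [lam [bs [inJ maxJ J'E]]] := step j.
  have [rest [pJ sJ sz sr bs0]] := jdims_max (jJ j) (HL j) inJ maxJ.
  have kbs : n - n' <= size bs by have := rn' j; lia.
  have [jJ' HL'] := jreduce_jnf (jJ j) (HL j) inJ kbs.
  have [uJ H1 _] := jJ j.
  rewrite subKn // -J'E in jJ' HL'.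
  split=> // i.
    rewrite /c /s sJ /=; case: i => [|i] /=.
      rewrite /partial_dim /= (perm_sumn (permEl (perm_sort _ _))) sr.
      by have := rn' j; lia.
    by rewrite /jdims /partial_dim sJ.
  rewrite J'E /jdims (partial_dim_jreduce uJ _ inJ kbs pJ) /c /s ?sJ //.
  by move=> y yJ; rewrite (HL j) // andbT; case: (H1 y yJ).
split=> //.
- by move=> j; case: (cE j).
- by move=> j; case: (cE j).
- rewrite (_ : (fun j => _) = fun j => partial_dim (sort geq (c j))); last first.
    by apply/funext => j; apply/funext => i; case: (cE j).
  apply: has_brick_sort => //.
  rewrite (_ : (fun j => _) = set_root (fun j => jdims (J j)) (fun=> n')) //.
  by apply/funext => j; apply/funext => i; case: (cE j).
Qed.

Lemma jbrick_reduction n (J : 'I_p.+1 -> jnf F) s ns Js :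
  jbrick n J -> reduction_seq n J s ns Js ->
  omega (ns s) (Js s) \/ ns s = 1.
Proof.
move=> hJ [[ns0 Js0] step st].
have hs v : v <= s -> jbrick (ns v) (Js v).
  elim: v => [|v IH] vs; first by rewrite ns0 Js0.
  have [nst nsE jst] := step v vs.
  exact: jbrick_step (IH (ltnW vs)) nst nsE jst.
case: st => [|nb|]; [by left| |by right].
have [s1|s1] := eqVneq (ns s) 1; first by right.
case: nb; apply: jbrick_beta (hs s (leqnn s)) _.
by rewrite ltn_neqAle eq_sym s1; exact: jbrick_gt0 (hs s (leqnn s)).
Qed.
End JordanReduction.

Section JordanBrick.
Context {F : fieldType} {N p : nat}.
Local Notation M := 'M[F]_N.+1.

Lemma eigen_prod_similar n (P A B : 'M[F]_n) es : P *m A = B *m P ->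
  P *m eigen_prod es A = eigen_prod es B *m P.
Proof.
move=> PAB; rewrite /eigen_prod; elim: es => [|e es IH].
  by rewrite !big_nil [LHS]mulmx1 [RHS]mul1mx.
rewrite !big_cons; apply: etrans (mulmxA _ _ _) _.
rewrite mulmxBr PAB scalar_mxC -mulmxBl -mulmxA IH mulmxA //.
Qed.

Lemma has_jnf_rank n (A : 'M[F]_n) J es : has_jnf A J ->
  \rank (eigen_prod es A) = (\sum_(x <- jblocks J) (x.2 - count_mem x.1 es))%N.
Proof.
case=> _ [eJ [P uP /(similarP uP) PA]]; rewrite -rank_eigen_prod_diag.
case: _ / eJ A P uP PA => A P uP PA.
rewrite castmx_id in PA; have := eigen_prod_similar es PA.
move/(congr1 mxrank); rewrite (eqmxMfull _) ?row_full_unit // => ->.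
by rewrite mxrankMfree // row_free_unit.
Qed.

Lemma jnf_mem_leq n (J : jnf F) x : is_jnf n J -> x \in J -> all (geq n) x.2.
Proof.
move=> [_ _ <-] xJ; apply/allP => b bx /=; rewrite jsizeE.
rewrite (perm_sumn (perm_to_rem (map_f (fun x => sumn x.2) xJ))) /=.
by rewrite (perm_sumn (perm_to_rem bx)) /= -addnA leq_addr.
Qed.

(** A block with eigenvalue 0 would lower the rank. In the multiplicative case this makes the arm
    parameters nonzero, as [star_unit] demands. *)
Lemma jnf_unit_neq0 n (A : 'M[F]_n) J x : has_jnf A J -> A \in unitmx ->
  x \in J -> x.1 != 0.
Proof.
move=> hA uA xJ; apply/eqP => x0.
have := has_jnf_rank [:: 0] hA; have [[_ HJ szJ] _] := hA.
rewrite /eigen_prod big_seq1 raddf0 subr0 mxrank_unit // => nE.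
have [x2 x1] := HJ x xJ; case bE : x.2 x2 x1 => [//|b bs] _ /= /andP [b1 _].
have inb : (x.1, b) \in jblocks J.
  apply/flattenP; exists [seq (x.1, c) | c <- x.2]; first exact: map_f.
  by rewrite bE mem_head.
have : (n < n)%N; last by rewrite ltnn.
rewrite [X in (X < _)%N]nE -[X in (_ < X)%N]szJ /jsize sumnE big_map.
rewrite !(big_rem _ inb) /= x0 eqxx -addSn leq_add //; first by lia.
by apply: leq_sum => y _; rewrite leq_subr.
Qed.

Lemma partial_dim_eigen n (A : 'M[F]_n) J i : has_jnf A J ->
  \rank (eigen_prod
    (mkseq (nth 1 (flatten [seq nseq n x.1 | x <- J])) i) A) =
  partial_dim (jcolumns n J) i.
Proof.
move=> hA; rewrite (has_jnf_rank _ hA); have [jJ _] := hA; have [uJ _ _] := jJ.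
have HL x : x \in J -> all (geq n) x.2 by exact: jnf_mem_leq.
set es := flatten _.
have [le|lt] := leqP i (size es).
  rewrite -sum_eigen_columns //; apply: eq_big_seq => x _; congr (_ - count_mem _ _)%N.
  apply: (@eq_from_nth _ 1) => [|k]; rewrite size_mkseq ?size_takel // => ki.
  by rewrite nth_mkseq // nth_take.
have szE : size (jcolumns n J) = size es.
  rewrite /jcolumns !size_flatten /shape -!map_comp; congr sumn.
  by apply: eq_map => x; rewrite /= size_nseq size_map size_iota.
rewrite /partial_dim drop_oversize ?szE ?(ltnW lt) //=.
have := sum_eigen_columns (size es) uJ HL.
rewrite -/es take_size /partial_dim drop_oversize ?szE //=.
move/eqP; rewrite sum_nat_seq_eq0 => /allP all0.
apply/eqP; rewrite sum_nat_seq_eq0; apply/allP => x xJ.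
have := all0 x xJ; rewrite /= !subn_eq0 => /leq_trans; apply.
rewrite -(subnKC (ltnW lt)) /mkseq iotaD map_cat count_cat -/(mkseq _ _) mkseq_nth.
exact: leq_addr.
Qed.

(** The arm of [A j] runs through the eigenvalues one after the other, so its columns come grouped
    by eigenvalue; reflections along the arms sort them. *)
Lemma jnf_jbrick mul (A : 'I_p.+1 -> M) J :
  (forall j, has_jnf (A j) (J j)) -> center_rel mul 1 A ->
  (mul -> forall j, A j \in unitmx) -> trivial_centralizer A ->
  jbrick (N := N) mul N.+1 N.+1 J.
Proof.
move=> hA ctr uA triv; have jJ j : is_jnf N.+1 (J j) by case: (hA j).
split=> // [j x|]; first exact: jnf_mem_leq.
(* Past the end of the list the product already has rank 0, so the default value is free there; 1 is
   chosen to be nonzero. *)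
pose e j := nth 1 (flatten [seq nseq N.+1 x.1 | x <- J j]).
have := @initial_brick _ _ _ mul A e ctr.
rewrite (_ : (fun j => _) = fun j => partial_dim (jcolumns N.+1 (J j))).
  move=> hb; apply: has_brick_sort => //; apply: hb => [h j i|B BA].
    rewrite /e; have [lt|le] := ltnP i (size (flatten [seq nseq N.+1 x.1 | x <- J j])).
      have /flattenP [s /mapP [x xJ ->]] := mem_nth 1 lt.
      by rewrite mem_nseq => /andP [_ /eqP ->]; apply: jnf_unit_neq0 (hA j) (uA h j) xJ.
    by rewrite nth_default // oner_neq0.
  have /is_scalar_mxP [c ->] := triv B BA.
  by exists c; rewrite -[1]/(1%:M) scalemx1.
by apply/funext => j; apply/funext => i; exact: partial_dim_eigen.
Qed.
End JordanBrick.

(** * Dimensions of conjugacy classes *)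

Section Scott.
Context {F : fieldType}.

(** Factor each [f j] through a space of dimension [\rank (f j)]. The maps into and out of the
    direct sum of these spaces compose to 0, and each has rank at least [D - 1] because the kernels
    lie on the lines of [v] and [w]. *)
Lemma scott_inequality D m (f g : 'I_m -> 'M[F]_D) (v w : 'rV[F]_D) :
  \sum_j f j *m g j = 0 ->
  (forall x : 'rV_D, (forall j, x *m f j = 0) -> (x <= v)%MS) ->
  (forall y : 'rV_D, (forall j, f j *m g j *m y^T = 0) -> (y <= w)%MS) ->
  (2 * D - 2 <= \sum_j \rank (f j))%N.
Proof.
move=> fg0 kerf kerfg.
pose c j := col_base (f j); pose b j := row_base (f j).
have cb j : c j *m b j = f j by exact: mulmx_base.
have RC : (\mxrow_j c j) *m (\mxcol_j (b j *m g j)) = 0.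
  by rewrite mul_mxrow_mxcol -[RHS]fg0; apply: eq_bigr => j _; rewrite mulmxA cb.
have small k (K : 'M[F]_(k, D)) (u : 'rV_D) :
    (forall x : 'rV_D, (x <= K)%MS -> (x <= u)%MS) -> (\rank K <= 1)%N.
  move=> Ku; apply: leq_trans (rank_leq_row u); apply: mxrankS.
  by apply/rV_subP => x /Ku.
have := mulmx0_rank_max RC.
have : (D - \rank (\mxrow_j c j) <= 1)%N.
  rewrite -mxrank_ker; apply: (small _ _ v) => x /sub_kermxP xR; apply: kerf => j.
  have := congr1 (fun X => submxrow X j) xR.
  rewrite mul_mxrow mxrowK submxrow0 => xc.
  have -> : x *m f j = x *m c j *m b j by rewrite -mulmxA cb.
  by rewrite xc mul0mx.
have : (D - \rank (\mxcol_j (b j *m g j)) <= 1)%N.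
  rewrite -mxrank_tr -mxrank_ker; apply: (small _ _ w) => y /sub_kermxP yC.
  apply: kerfg => j; have := congr1 (fun X => submxcol X^T j) yC.
  rewrite trmx_mul trmxK mxcol_mul mxcolK trmx0 submxcol0 => Cy.
  have -> : f j *m g j *m y^T = c j *m (b j *m g j *m y^T)
    by rewrite [RHS]mulmxA (mulmxA (c j)) cb.
  by rewrite Cy mulmx0.
by lia.
Qed.

Definition commutator n (A X : 'M[F]_n) : 'M[F]_n := X *m A - A *m X.

Definition ad_mx n (A : 'M[F]_n) : 'M[F]_(n * n) := lin_mulmxr A - lin_mulmx A.

Lemma mul_mxvec_ad n (A X : 'M[F]_n) : mxvec X *m ad_mx A = mxvec (commutator A X).
Proof. by rewrite mulmxBr !mul_vec_lin -linearB. Qed.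

Definition sandwich_mx n (P S : 'M[F]_n) : 'M[F]_(n * n) :=
  lin_mulmx P *m lin_mulmxr S.

Lemma mul_mxvec_sandwich n (P S Z : 'M[F]_n) :
  mxvec Z *m sandwich_mx P S = mxvec (P *m Z *m S).
Proof. by rewrite mulmxA !mul_vec_lin. Qed.

Lemma mxvec_scalar_mx n (c : F) : mxvec c%:M = c *: mxvec (1%:M : 'M[F]_n).
Proof. by rewrite -[in LHS]scalemx1 linearZ. Qed.

Lemma mxvec_pairing n (Z Y : 'M[F]_n) : mxvec Z *m (mxvec Y)^T = (\tr (Z *m Y^T))%:M.
Proof.
apply/rowP => k; rewrite mxE [RHS]mxE ord1 mulr1n /mxtrace.
rewrite (reindex _ (curry_mxvec_bij _ _)) /=.
under [RHS]eq_bigr do rewrite mxE.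
rewrite pair_bigA; apply: eq_bigr => [[i j]] /= _.
by rewrite !mxE !mxvecE.
Qed.

Lemma mxtrace_nondegenerate n (B : 'M[F]_n) :
  (forall X, \tr (X *m B) = 0) -> B = 0.
Proof.
move=> trB; apply/matrixP => i j; rewrite [RHS]mxE -(trB (delta_mx j i)).
rewrite /mxtrace (bigD1 j) //= big1 ?addr0 => [|k kj].
  rewrite mxE (bigD1 i) //= big1 ?addr0 => [|l li]; first by rewrite mxE !eqxx mul1r.
  by rewrite mxE (negPf li) andbF mul0r.
by rewrite mxE big1 // => l _; rewrite mxE (negPf kj) mul0r.
Qed.

(* Scott's lemma for the adjoint action; the matrices P j and S j absorb the
   telescoping of a product, and are identities for a sum. *)
Lemma ad_rank_ge n m (A P S : 'I_m -> 'M[F]_n) :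
  trivial_centralizer A ->
  (forall X, \sum_j P j *m commutator (A j) X *m S j = 0) ->
  (forall Y, (forall j, A j *m (S j *m Y *m P j) = S j *m Y *m P j *m A j) ->
     forall j, Y *m A j = A j *m Y) ->
  (2 * (n * n) - 2 <= \sum_j \rank (ad_mx (A j)))%N.
Proof.
move=> triv sum0 comm.
have scal X : (forall j, X *m A j = A j *m X) -> (mxvec X <= mxvec (1%:M : 'M[F]_n))%MS.
  by move=> /triv/is_scalar_mxP [c ->]; rewrite mxvec_scalar_mx scalemx_sub.
apply: (scott_inequality (g := fun j => sandwich_mx (P j) (S j))
  (v := mxvec 1%:M) (w := mxvec 1%:M)) => [|x xA|y yA].
- apply/row_matrixP => i; rewrite row0 rowE -[delta_mx 0 i]vec_mxK.
  set X := vec_mx _; rewrite mulmx_sumr.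
  rewrite (eq_bigr (fun j => mxvec (P j *m commutator (A j) X *m S j))) => [|j _].
    by rewrite -linear_sum /= sum0 linear0.
  by rewrite mulmxA mul_mxvec_ad mul_mxvec_sandwich.
- rewrite -[x]vec_mxK; apply: scal => j; apply/eqP; rewrite -subr_eq0; apply/eqP.
  apply: (can_inj mxvecK); rewrite linear0.
  rewrite -[X in mxvec X]/(commutator (A j) (vec_mx x)).
  by rewrite -mul_mxvec_ad vec_mxK.
rewrite -[y]vec_mxK; set Y := vec_mx y.
(* Orthogonality of [Y] to all [P j *m commutator (A j) X *m S j] under the trace form becomes, by
   cyclicity and nondegeneracy, a commutation relation for the transpose of [Y]. *)
have tY : forall j, Y^T *m A j = A j *m Y^T.
  apply: comm => j; apply/eqP; rewrite -subr_eq0; apply/eqP.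
  apply: mxtrace_nondegenerate => X.
  have /matrixP/(_ 0 0) : mxvec (P j *m commutator (A j) X *m S j) *m (mxvec Y)^T = 0.
    rewrite -mul_mxvec_sandwich -mul_mxvec_ad.
    by rewrite /Y vec_mxK -2!mulmxA (mulmxA (ad_mx _)) yA mulmx0.
  rewrite mxvec_pairing !mxE mulr1n => tr0.
  apply: etrans tr0; rewrite /commutator mulmxBr mulmxBr !mulmxBl !raddfB /=.
  congr (_ - _); first by rewrite -!mulmxA [RHS]mxtrace_mulC -!mulmxA.
  by rewrite -!mulmxA (mulmxA (P j) (A j)) [RHS]mxtrace_mulC -!mulmxA.
have /is_scalar_mxP [c Yc] : is_scalar_mx Y^T by apply: triv.
by rewrite -[Y]trmxK Yc tr_scalar_mx mxvec_scalar_mx scalemx_sub.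
Qed.
End Scott.

Section TupleScott.
Context {F : fieldType} {N m : nat}.
Local Notation M := 'M[F]_N.+1.

Lemma ad_rank_sum (A : 'I_m -> M) : trivial_centralizer A -> \sum_j A j = 0 ->
  (2 * (N.+1 * N.+1) - 2 <= \sum_j \rank (ad_mx (A j)))%N.
Proof.
move=> triv sumA.
have := @ad_rank_ge F N.+1 m A (fun=> 1%:M) (fun=> 1%:M) triv; apply=> [X|Y YA j].
  under eq_bigr do rewrite mulmx1 mul1mx.
  by rewrite /commutator sumrB -mulmx_sumr -mulmx_suml sumA mulmx0 mul0mx subrr.
by have := YA j; rewrite mulmx1 mul1mx => ->.
Qed.

(** Take the products before and after the [j]-th factor. With [T k = P k * X * S k] the [j]-th
    summand is [T j - T j.+1], and [T 0 = T m = X] because the whole product is 1. *)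
Lemma ad_rank_prod (A : 'I_m -> M) : trivial_centralizer A -> \prod_j A j = 1 ->
  (2 * (N.+1 * N.+1) - 2 <= \sum_j \rank (ad_mx (A j)))%N.
Proof.
move=> triv prodA.
pose A' := extend_fun A.
pose P k : M := \prod_(0 <= l < k) A' l.
pose S k : M := \prod_(k <= l < m) A' l.
have PS (j : 'I_m) : P j.+1 = P j * A j.
  by rewrite /P big_nat_recr //= /A' extend_funE.
have SS (j : 'I_m) : S j = A j * S j.+1.
  by rewrite /S big_ltn // /A' extend_funE.
have PA k : (k <= m)%N -> P k * S k = 1.
  move=> km; rewrite /P /S -big_cat_nat //= big_mkord -[RHS]prodA.
  by apply: eq_bigr => j _; rewrite /A' extend_funE.
have P0 : P 0 = 1 by rewrite /P big_nil.
have Sm : S m = 1 by rewrite /S big_geq.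
have := @ad_rank_ge F N.+1 m A (fun j => P j) (fun j => S j.+1) triv; apply=> [X|Y YA].
  pose T k := P k * X * S k.
  transitivity (\sum_(0 <= k < m) (- T k.+1 - - T k)).
    rewrite big_mkord; apply: eq_bigr => j _; rewrite opprK addrC /T PS SS.
    rewrite -[LHS]/(P j * (X * A j - A j * X) * S j.+1) mulrBr mulrBl.
    by rewrite !mulrA.
  rewrite (telescope_sumr (fun k => - T k) (leq0n m)) /T opprK addrC.
  have := PA m (leqnn m); have := PA 0 isT; rewrite P0 Sm mul1r mulr1 => -> ->.
  by rewrite mul1r mulr1 subrr.
(* Once [Y] commutes with the factors before [A j], the hypothesis reduces to commutation with
   [A j]; induction then runs over the prefixes. *)
have YcA (j : 'I_m) : Y * P j = P j * Y -> Y * A j = A j * Y.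
  move=> YPj; have ASP : A j * S j.+1 * P j = 1.
    by apply: mulmx1C; rewrite -SS; exact: PA (ltnW (ltn_ord j)).
  have YE : Y = S j.+1 * P j * Y * A j.
    transitivity (S j.+1 * Y * P j * A j); last by rewrite -(mulrA (S _)) YPj mulrA.
    rewrite -[RHS](YA j) -[RHS]/(A j * (S j.+1 * Y * P j)).
    by rewrite -(mulrA (S _)) YPj !mulrA ASP mul1r.
  by rewrite [in RHS]YE !mulrA ASP mul1r.
have YP k : (k <= m)%N -> Y * P k = P k * Y.
  elim: k => [|k IH] km; first by rewrite P0 mulr1 mul1r.
  have {}IH := IH (ltnW km); have PSk := PS (Ordinal km); rewrite /= in PSk.
  by rewrite PSk mulrA IH -!mulrA (YcA (Ordinal km) IH).
by move=> j; apply/YcA/YP/ltnW.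
Qed.
End TupleScott.

(** * Lower bound for the dimension of a conjugacy class *)

Section OrbitDimension.
Context {F : fieldType}.
Hypothesis nonroot : forall q : {poly F}, q != 0 -> exists x, q.[x] != 0.

Lemma digits_inj K k (a b : 'I_k -> nat) :
  (forall i, a i < K)%N -> (forall i, b i < K)%N ->
  (\sum_(i < k) K ^ i * a i = \sum_(i < k) K ^ i * b i)%N -> forall i, a i = b i.
Proof.
elim: k a b => [|k IH] a b aK bK; first by move=> _ [].
rewrite !big_ord_recl !expn0 !mul1n.
have shift (c : 'I_k.+1 -> nat) :
    (\sum_(i < k) K ^ lift ord0 i * c (lift ord0 i) =
     K * \sum_(i < k) K ^ i * c (lift ord0 i))%N.
  by rewrite big_distrr; apply: eq_bigr => i _; rewrite /= /bump leq0n expnS mulnA.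
rewrite !shift => E.
have K0 : (0 < K)%N by exact: leq_ltn_trans (aK ord0).
have E0 : a ord0 = b ord0.
  by have := congr1 (modn^~ K) E; rewrite ![(_ + K * _)%N]addnC
      ![(K * _)%N]mulnC !modnMDl !modn_small.
move: E; rewrite E0 => /addnI/eqP; rewrite eqn_pmul2l // => /eqP /IH E i.
by case: (unliftP ord0 i) => [j|] ->; rewrite ?E0 //; apply: E.
Qed.

Lemma monomials_nonroot k (ms : seq 'X_{1..k}) (c : 'X_{1..k} -> F) m0 :
  uniq ms -> m0 \in ms -> c m0 != 0 ->
  exists y : 'I_k -> F, \sum_(m <- ms) c m * \prod_i y i ^+ m i != 0.
Proof.
move=> ums m0s cm0.
pose K := (\max_(m <- ms) mdeg m).+1.
have mK m : m \in ms -> forall i, (m i < K)%N.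
  move=> mms i; rewrite /K ltnS (leq_trans (_ : _ <= mdeg m)%N) //.
    by rewrite mdegE (bigD1 i) //= leq_addr.
  by rewrite (big_rem m) //= leq_maxl.
(* Kronecker substitution: the monomials get pairwise distinct degrees. *)
pose wt (m : 'X_{1..k}) := (\sum_(i < k) K ^ i * m i)%N.
pose h : {poly F} := \sum_(m <- ms) c m *: 'X^(wt m).
have h0 : h != 0.
  apply/eqP => /polyP/(_ (wt m0)); rewrite coef0 coef_sum (bigD1_seq m0) //=.
  rewrite coefZ coefXn eqxx mulr1 big_seq_cond big1 ?addr0 => [/eqP|m /andP [mms mm0]].
    by rewrite (negPf cm0).
  rewrite coefZ coefXn; case: eqP => [wE|_]; last by rewrite mulr0.
  case/eqP: mm0; apply/mnmP => i.
  exact: esym (digits_inj (mK _ m0s) (mK _ mms) wE i).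
have [s hs] := nonroot h0; exists (fun i : 'I_k => s ^+ (K ^ i)).
suff <- : h.[s] = \sum_(m <- ms) c m * \prod_(i < k) (s ^+ (K ^ i)) ^+ m i by [].
rewrite horner_sum; apply: eq_bigr => m _; rewrite hornerZ hornerXn; congr (_ * _).
by rewrite /wt -prodrXr; apply: eq_bigr => i _; rewrite exprM.
Qed.

(* Along the curve t |-> (1 + tX) A (1 + tX)^-1 the coordinates centered at A
   are t (y + O(t)), y being their value at [X, A]; so the lowest homogeneous
   part of an algebraic relation vanishes at y, which is arbitrary. *)
Lemma dim_conj_class_ge n (A : 'M[F]_n) :
  (\rank (ad_mx A) <= dim_set (conj_class A))%N.
Proof.
pose T := ad_mx A; pose r := \rank T.
(* [B] gives coordinates on the image of the adjoint map, and [f] will be these coordinates centered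
   at [A]; [C] produces a preimage of any prescribed coordinates. *)
have [B bB] := row_freeP (row_base_free T).
have [C Cc] := row_fullP (col_base_full T).
have rle : (r < (n * n).+1)%N by rewrite ltnS rank_leq_row.
suff : `[< exists f : 'I_r -> {mpoly F[n * n]}, alg_independent_on (conj_class A) f >].
  move=> ind; rewrite /dim_set -/T -/r.
  apply: (leq_bigmax_cond (F := fun k : 'I_(n * n).+1 => k : nat) (Ordinal rle)).
  exact: ind.
apply/asboolP.
pose f (i : 'I_r) : {mpoly F[n * n]} :=
  \sum_l B l i *: 'X_l - ((mxvec A *m B) 0 i)%:MP.
have feval i Z : (f i).@[fun l => mxvec Z ord0 l] = (mxvec (Z - A) *m B) 0 i.
  rewrite /f mevalB mevalC linearB mulmxBl [RHS]mxE [X in _ = _ + X]mxE; congr (_ - _).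
  rewrite mxE raddf_sum; apply: eq_bigr => l _.
  by rewrite /= mevalZ mevalXU mulrC.
exists f => P Pf0; apply/eqP; apply: contraT => P0.
have [m0 m0P m0min] : exists2 m0, m0 \in msupp P &
    forall m, m \in msupp P -> (mdeg m0 <= mdeg m)%N.
  have : msupp P != [::] by rewrite msupp_eq0.
  elim: (msupp P) => [//|m ms IH] _; have [->|/IH [m1 m1s m1min]] := eqVneq ms [::].
    by exists m => [|m']; rewrite ?mem_head // inE => /eqP ->.
  have [le|lt] := leqP (mdeg m) (mdeg m1).
    exists m; first by rewrite mem_head.
    by move=> m'; rewrite inE => /orP [/eqP -> //|/m1min]; exact: leq_trans.
  exists m1; first by rewrite inE m1s orbT.
  by move=> m'; rewrite inE => /orP [/eqP ->|/m1min //]; exact: ltnW.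
pose ms := [seq m <- msupp P | mdeg m == mdeg m0].
have [|||y] := @monomials_nonroot _ ms (fun m => P@_m) m0.
- exact/filter_uniq/msupp_uniq.
- by rewrite mem_filter eqxx.
- by rewrite mcoeff_eq0 negbK.
case/eqP.
pose X : 'M[F]_n := vec_mx ((\row_i y i) *m C).
have XB : mxvec (commutator A X) *m B = \row_i y i.
  rewrite -mul_mxvec_ad -/T vec_mxK.
  transitivity (\row_i y i *m C *m (col_base T *m row_base T) *m B).
    by rewrite mulmx_base.
  by rewrite -(mulmxA _ _ B) -(mulmxA _ _ B) bB mulmx1 -mulmxA Cc mulmx1.
(* The inverse of [1 + tX] is its adjugate over [q], so the coordinates along the curve are
   [t * q^-1 * U i] with polynomials [q] and [U i]. *)
pose g : 'M[{poly F}]_n := 1%:M + 'X *: map_mx polyC X.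
pose q := \det g.
pose Um : 'M[{poly F}]_n := map_mx polyC (commutator A X) *m \adj g.
pose U i : {poly F} := (mxvec Um *m map_mx polyC B) 0 i.
have gt t : map_mx (horner_eval t) g = 1%:M + t *: X.
  rewrite map_mxD map_mx1 map_mxZ /= /horner_eval hornerX -map_mx_comp.
  by rewrite map_mx_id // => x /=; rewrite /horner_eval hornerC.
have qt t : q.[t] = \det (1%:M + t *: X).
  by rewrite -gt det_map_mx.
have Ut t i : (U i).[t] = (mxvec (commutator A X *m \adj (1%:M + t *: X)) *m B) 0 i.
  have polyCK k l (Z : 'M[F]_(k, l)) : map_mx (horner_eval t) (map_mx polyC Z) = Z.
    by rewrite -map_mx_comp map_mx_id // => x /=; rewrite /horner_eval hornerC.
  transitivity (map_mx (horner_eval t) (mxvec Um *m map_mx polyC B) 0 i).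
    by rewrite mxE.
  by rewrite map_mxM map_mxvec /Um map_mxM !polyCK map_mx_adj gt.
have fZ t : q.[t] != 0 -> P.@[fun i => t * q.[t]^-1 * (U i).[t]] = 0.
  move=> qt0; pose h := 1%:M + t *: X.
  have uh : h \in unitmx by rewrite unitmxE unitfE -qt.
  pose Z := h *m A *m invmx h.
  have cZ : conj_class A Z by exists h => //; apply/similarP => //; rewrite mulmxKV.
  rewrite -[RHS](Pf0 Z cZ); apply: meval_eq => i; rewrite feval Ut.
  have -> : Z - A = (t * q.[t]^-1) *: (commutator A X *m \adj h).
    rewrite -{1}[A](mulmxK uh) -mulmxBl /h mulmxDl mulmxDr mul1mx mulmx1 opprD.
    rewrite addrACA subrr add0r -scalemxAl -scalemxAr -scalerBr -scalemxAl -scalerA.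
    by congr (_ *: _); rewrite /invmx uh -scalemxAr qt.
  by rewrite linearZ /= -scalemxAl [RHS]mxE.
(* [G] is the relation [P] along the curve multiplied by [q ^+ msize P], a power large enough to
   clear every denominator. *)
pose V (m : 'X_{1..r}) : {poly F} := \prod_i U i ^+ m i * q ^+ (msize P - mdeg m).
pose G : {poly F} := \sum_(m <- msupp P) P@_m *: ('X^(mdeg m) * V m).
have q0 : q.[0] = 1 by rewrite qt scale0r addr0 det1.
have G0 : G = 0.
  apply/eqP; apply: contraT => G_neq0.
  have q_neq0 : q != 0.
    by apply/eqP => qE; move: q0; rewrite qE horner0 => /esym/eqP; rewrite oner_eq0.
  have [t] := nonroot (mulf_neq0 q_neq0 G_neq0).
  rewrite hornerM mulf_eq0 negb_or => /andP [qt0 /eqP []].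
  transitivity (q.[t] ^+ msize P * P.@[fun i => t * q.[t]^-1 * (U i).[t]]); last first.
    by rewrite fZ // mulr0.
  rewrite mevalE mulr_sumr horner_sum; apply: eq_big_seq => m mP.
  rewrite hornerZ hornerM hornerXn /V hornerM horner_prod horner_exp [RHS]mulrCA.
  congr (_ * _); under [in RHS]eq_bigr do rewrite exprMn.
  rewrite big_split prodrXr -mdegE /=.
  under eq_bigr do rewrite horner_exp.
  rewrite -{2}(subnK (ltnW (msize_mdeg_lt mP))) exprD exprMn exprVn.
  rewrite mulrA [RHS]mulrA [_ ^+ _ * \prod__ _]mulrC.
  rewrite -[LHS]mulrA [LHS]mulrC; congr (_ * _).
  by rewrite mulrACA mulfV ?expf_neq0 // mulr1 mulrC.
(* In the coefficient of degree [mdeg m0] only the monomials of least degree survive, evaluated at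
   [t = 0], where [q] is 1 and [U i] is [y i]. *)
move/polyP/(_ (mdeg m0)): G0; rewrite coef0 => Gd; apply: etrans Gd.
rewrite /G coef_sum /ms big_filter [LHS]big_mkcond; apply: eq_big_seq => m mP.
rewrite coefZ coefXnM; have le := m0min m mP.
case: eqP => [->|/eqP ne]; last by rewrite ltn_neqAle eq_sym ne le mulr0.
rewrite ltnn subnn -horner_coef0 /V hornerM horner_prod horner_exp q0 expr1n mulr1.
congr (_ * _); apply: eq_bigr => i _; rewrite horner_exp Ut scale0r addr0.
by rewrite (_ : \adj 1%:M = 1%:M) ?mulmx1 ?XB ?mxE // -[LHS]mulmx1 mul_adj_mx det1.
Qed.
End OrbitDimension.

Lemma jdim_conj_class (F : fieldType) n (A : 'M[F]_n) J : has_jnf A J ->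
  jdim J = dim_set (conj_class A).
Proof.
case=> _ [eJ [P uP /(similarP uP) PA]]; rewrite /jdim.
case: _ / eJ A P uP PA => A P uP PA; rewrite castmx_id in PA.
congr dim_set; apply/seteqP; split=> B [Q uQ /(similarP uQ) QB].
  exists (Q *m P); first by rewrite unitmx_mul uQ.
  by apply/similarP; rewrite ?unitmx_mul ?uQ // -mulmxA PA mulmxA QB mulmxA.
exists (Q *m invmx P); first by rewrite unitmx_mul uQ unitmx_inv.
apply/similarP; first by rewrite unitmx_mul uQ unitmx_inv.
have PJ : invmx P *m jordan_mx J = A *m invmx P.
  by rewrite -[LHS](mulmxK uP) -(mulmxA (invmx P)) -PA mulmxA mulVmx // mul1mx.
by rewrite -mulmxA PJ !mulmxA QB.
Qed.

Local Open Scope classical_set_scope.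

Theorem theorem7 (R : realType) (n p : nat) (hn : (1 < n)%N)
    (Cl : 'I_p.+1 -> set 'M[R[i]]_n) (J : 'I_p.+1 -> jnf R[i])
    (hCl : forall j, is_conj_class (Cl j))
    (hJ : forall j Y, Cl j Y -> has_jnf Y (J j))
    (hM :
      ((forall j, Cl j `<=` [set Y | Y \in unitmx]) /\
       exists M : 'I_p.+1 -> 'M[R[i]]_n,
         [/\ forall j, Cl j (M j),
             \big[mulmx/1%:M]_(j < p.+1) M j = 1%:M
           & trivial_centralizer M])
      \/
      (exists A : 'I_p.+1 -> 'M[R[i]]_n,
         [/\ forall j, Cl j (A j),
             \sum_(j < p.+1) A j = 0
           & trivial_centralizer A])) :
  (alpha n J /\ beta n J) /\
  (forall (s : nat) (ns : nat -> nat) (Js : nat -> 'I_p.+1 -> jnf R[i]),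
     reduction_seq n J s ns Js ->
     omega (ns s) (Js s) \/ ns s = 1%N).
Proof.
case: n hn Cl hCl hJ hM => [//|N] hn Cl _ hJ hM.
have nonroot (q : {poly R[i]}) : q != 0 -> exists x, q.[x] != 0.
  exact: (@closed_nonrootP R[i] q).
(* Both problems reduce to one statement with center the whole space: the product 1 is the scalar
   [q = 1], and the sum 0 is the scalar [t = 0]. *)
suff [mul [A [hA ctr uA triv rk]]] : exists mul (A : 'I_p.+1 -> 'M[R[i]]_N.+1),
    [/\ forall j, has_jnf (A j) (J j), center_rel mul 1 A,
        mul -> forall j, A j \in unitmx, trivial_centralizer A
      & (2 * (N.+1 * N.+1) - 2 <= \sum_j \rank (ad_mx (A j)))%N].
  have hb := jnf_jbrick hA ctr uA triv.
  split; [split|]; last by move=> s ns Js; exact: (jbrick_reduction hb).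
    rewrite /alpha -mulnn (leq_trans rk) // leq_sum // => j _.
    by rewrite (jdim_conj_class (hA j)); exact: (dim_conj_class_ge nonroot).
  exact: (jbrick_beta hb).
case: hM => [[hu [A [hA prodA triv]]]|[A [hA sumA triv]]].
  exists true, A; split=> //; [by move=> j; exact: hJ| | |].
  - exists 1; first exact: oner_neq0.
    rewrite !subrr scale0r addr0 -[RHS]prodA; apply: eq_bigr => j _.
    by rewrite add0r.
  - by move=> _ j; exact: hu (hA j).
  - exact: ad_rank_prod.
exists false, A; split=> //; [by move=> j; exact: hJ| |].
  by exists 0; rewrite sumA scale0r.
exact: ad_rank_sum.
Qed.
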